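(* Let $k \in \mathbb{N}$, $k\ge 2$ be fixed. Then $$\sum_{n_1,\dots,n_k \le x} B\left( \left[ n_1,\dotsc,n_k \right] \right) = k x^k \log \log \sqrt{x} + H_k x^k + O \left( \frac{x^k}{\log x} \right),$$ where $$H_k := k F + \sum_{j=2}^k (-1)^{j-1} \binom{k}{j} \sum_p \frac{1}{p^{j-1}(p^j-1)}, \qquad F:= \gamma + \sum_p \left( \log \left( 1 - \frac{1}{p} \right) + \frac{1}{p-1} \right).$$
   Context: $\mathbb{N}=\{1,2,\ldots\}$. For a positive integer $n$, $A(n)=\sum_{p^\nu \| n} \nu p$ (sum over the prime powers $p^\nu$, $\nu\ge1$, exactly dividing $n$), $A^*(n)=\sum_{p\mid n} p$ (sum over the distinct prime divisors of $n$), and $B(n)=A(n)-A^*(n)$. $[n_1,\ldots,n_k]$ denotes the least common multiple; the sum runs over all $k$-tuples of positive integers not exceeding $x$. $\gamma$ is Euler's constant; $\sum_p$ runs over all primes. The asymptotic formula is for real $x\to\infty$; the implied constant may depend on $k$. *)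

(* Defs.v *)
From mathcomp Require Import all_boot all_order all_algebra.
From mathcomp Require Import all_classical all_reals all_analysis.
Set Implicit Arguments. Unset Strict Implicit. Unset Printing Implicit Defensive.
Import Order.TTheory GRing.Theory Num.Theory.
Import numFieldNormedType.Exports.
Local Open Scope ring_scope.

(* Makes the filter at +oo usable in Landau notations. *)
Canonical pinfty_filter_on (R : numFieldType) :=
  FilterType (pinfty_nbhs R) (@filter_filter _ _ proper_pinfty_nbhs).

(* A(n) and A^*(n): the sum of the prime divisors of n, counted with and
   without multiplicity. *)
Definition primesumA (n : nat) : nat := (\sum_(p <- primes n) logn p n * p)%N.

Definition primesumAstar (n : nat) : nat := (\sum_(p <- primes n) p)%N.

(* The difference is taken in int, as subtraction on nat truncates. *)
Definition primesumB (n : nat) : int := (primesumA n)%:Z - (primesumAstar n)%:Z.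

Definition lcm_tuple (k N : nat) (n : {ffun 'I_k -> 'I_N}) : nat :=
  \big[lcmn/1%N]_(i < k) (n i : nat).

(* For x >= 0 the k-tuples of positive integers not exceeding x are the maps
   from 'I_k to {0, ..., floor(x)} taking only nonzero values. *)
Definition sum_B_lcm (R : realType) (k : nat) (x : R) : R :=
  \sum_(n : {ffun 'I_k -> 'I_(Num.truncn x).+1} | [forall i, (0 < n i)%N])
    (primesumB (lcm_tuple n))%:~R.

Definition euler_gamma (R : realType) : R :=
  limn (fun n : nat => \sum_(1 <= i < n.+1) i%:R^-1 - ln n%:R : R).

Definition sum_primes (R : realType) (f : nat -> R) : R :=
  limn (fun N : nat => \sum_(0 <= p < N | prime p) f p).

Definition constF (R : realType) : R :=
  euler_gamma R
  + sum_primes (fun p => ln (1 - p%:R^-1) + (p%:R - 1)^-1).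

Definition constH (R : realType) (k : nat) : R :=
  k%:R * constF R
  + \sum_(2 <= j < k.+1) (-1) ^+ (j - 1)%N * 'C(k, j)%:R
      * sum_primes (fun p => (p%:R ^+ (j - 1)%N * (p%:R ^+ j - 1))^-1).

(* Main.v *)
Require Import Defs.
From mathcomp Require Import all_boot all_order all_algebra.
From mathcomp Require Import all_classical all_reals all_analysis.
From mathcomp Require Import zify ring lra.
Set Implicit Arguments. Unset Strict Implicit. Unset Printing Implicit Defensive.
Import Order.TTheory GRing.Theory Num.Theory.
Import numFieldNormedType.Exports.
Local Open Scope classical_set_scope.
Local Open Scope ring_scope.

(** The sum is evaluated prime by prime. A prime power p^v divides the lcm of
    a tuple exactly when it divides one of the entries, so with N = floor x
    the prime p contributes p times the sum over v >= 2 of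
    N^k - (N - floor (N / p^v))^k ([sum_B_lcmE]). Dropping the floors and
    summing the geometric series over v replaces this contribution by N^k
    times the weight
      k / (p - 1) + sum_(2 <= j <= k) (-1)^(j-1) C(k,j) / (p^(j-1) (p^j - 1)),
    with an error O(N^k p log_p N / N) ([lcm_count_weight]). Only the primes
    p <= sqrt N contribute, and by Chebyshev's estimate for
    theta(y) = sum_(p <= y) ln p the errors add up to O(N^k / ln N)
    ([sum_trunc_log]). As k / (p - 1) is k / p plus a summable term, the
    weights of the primes up to sqrt x add up to k ln ln (sqrt x) + H_k +
    O(1 / ln x), by Mertens' theorem ([prime_sum_prime_weight]).

    Mertens' theorem is needed with its error term and its constant:
      sum_(p <= n) 1/p = ln ln n + M + O(1 / ln n),
      M = gamma - E,  E = sum_p (- ln (1 - 1/p) - 1/p).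
    The error term comes from the factorization of n! and partial summation
    ([mertens_first], [mertens_second]). The constant is found by expanding
    sum_p p^(-1-d) in two ways as d tends to 0 ([mertens_constant]). The Euler
    product of zeta(1 + d), which lies between 1/d and 1 + 1/d, gives
    - ln d - E + O(d) ([prime_sum_zterm_bounds]). Grouping the primes into the
    blocks (2^(m-1), 2^m] gives, up to a factor tending to 1, the power series
    at z = 2^(-d) whose coefficients have the partial sums
    ln m + ln ln 2 + M + O(1/m). The coefficients 1/m have the partial sums
    ln m + gamma + O(1/m) and the generating function - ln (1 - z); by Abel's
    argument the series is therefore - ln (1 - z) + ln ln 2 + M - gamma + o(1)
    ([dyadic_series]), and 1 - z is asymptotic to d ln 2. *)

(** * Primorials *)

Lemma big_nat_recr_cond (T : Type) (idx : T) (op : Monoid.law idx) n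
    (P : pred nat) (F : nat -> T) :
  \big[op/idx]_(0 <= i < n.+1 | P i) F i =
  op (\big[op/idx]_(0 <= i < n | P i) F i) (if P n then F n else idx).
Proof. by rewrite big_mkcond big_nat_recr //= -big_mkcond. Qed.

Lemma prime_dvd_fact p n : prime p -> (p %| n`!)%N = (p <= n)%N.
Proof.
move=> pp; apply/idP/idP => [|pn]; last by rewrite dvdn_fact // prime_gt0.
elim: n => [|n IH]; first by rewrite fact0 dvdn1 => /eqP p1; rewrite p1 in pp.
rewrite factS Euclid_dvdM // => /orP[/dvdn_leq->//|/IH]; lia.
Qed.

Lemma dvdn_prod_primes (a b m : nat) :
  (forall p, prime p -> (a <= p < b)%N -> (p %| m)%N) ->
  (\prod_(a <= p < b | prime p) p %| m)%N.
Proof.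
elim: b => [|b IH] H; first by rewrite big_geq.
have [ab|ba] := leqP a b; last by rewrite big_geq.
rewrite big_mkcond big_nat_recr //= -big_mkcond.
have IHb : (\prod_(a <= p < b | prime p) p %| m)%N.
  by apply: IH => p pp ?; apply: H => //; lia.
case: ifP => pb; last by rewrite muln1.
rewrite Gauss_dvd ?IHb ?H //; first by lia.
rewrite coprime_sym prime_coprime // big_nat_cond.
apply: (big_ind (fun x => ~~ (b %| x)%N)) => [|x y nx ny|p /andP[/andP[_ pb'] pp]].
- by rewrite Euclid_dvd1.
- by rewrite Euclid_dvdM // negb_or nx.
by rewrite dvdn_prime2 //; lia.
Qed.

Lemma bin_mid_le m : ('C(m.*2.+1, m) <= 4 ^ m)%N.
Proof.
have Hs : 'C(m.*2.+1, m.+1) = 'C(m.*2.+1, m).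
  by rewrite -bin_sub; [congr 'C(_, _); lia | lia].
have H : ('C(m.*2.+1, m) + 'C(m.*2.+1, m.+1) <= 2 ^ m.*2.+1)%N.
  rewrite -[2%N]/(1 + 1)%N expnDn.
  rewrite (bigD1 (inord m)) //= inordK; last by lia.
  rewrite (bigD1 (inord m.+1)) /=; last first.
    by rewrite -val_eqE /= !inordK //; lia.
  rewrite inordK; last by lia.
  by rewrite !exp1n !muln1 addnA leq_addr.
move: H; rewrite Hs addnn -mul2n expnS leq_pmul2l // -mul2n expnM //.
Qed.

(** The primes in (m+1, 2m+1] divide the binomial coefficient C(2m+1, m),
    which is at most 4^m; the rest is strong induction. *)
Lemma primorial_le n : (\prod_(0 <= p < n.+1 | prime p) p <= 4 ^ n)%N.
Proof.
have [b le_nb] := ubnP n; elim: b => // b IH in n le_nb *.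
have [n2|n2] := leqP n 2.
  by case: n n2 {le_nb} => [|[|[|]]] // _; rewrite /index_iota /= !big_cons big_nil.
have [on|en] := boolP (odd n); last first.
  rewrite big_nat_recr_cond ifF; last first.
    apply/negP => pn; move: (odd_prime_gt2 (p := n)).
    by have := even_prime pn => -[]; [lia|rewrite (negbTE en)].
  have := IH n.-1; rewrite prednK; last by lia.
  move=> H; rewrite /= muln1; apply: leq_trans (H _) _; first by lia.
  by rewrite leq_exp2l //; lia.
have := odd_double_half n; rewrite on add1n; set m := n./2 => En.
rewrite -En; rewrite (@big_cat_nat _ _ _ m.+2) //=; last by lia.
have Hm : (\prod_(0 <= p < m.+2 | prime p) p <= 4 ^ m.+1)%N by apply: IH; lia.
have Hb : (\prod_(m.+2 <= p < m.*2.+2 | prime p) p <= 4 ^ m)%N.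
  apply: leq_trans (bin_mid_le m); apply: dvdn_leq; first by rewrite bin_gt0; lia.
  apply: dvdn_prod_primes => p pp /andP[p1 p2].
  have mb : (m <= m.*2.+1)%N by lia.
  have : (p %| m.*2.+1`!)%N by rewrite prime_dvd_fact.
  rewrite -(bin_fact mb) !Euclid_dvdM // !prime_dvd_fact //.
  by case/orP => // /orP[]; lia.
apply: leq_trans (leq_mul Hm Hb) _.
by rewrite -expnD leq_exp2l //; lia.
Qed.

(** * Counting tuples by prime powers *)

Lemma pfactor_dvd_lcm p v m n : prime p -> (0 < m)%N -> (0 < n)%N ->
  (p ^ v %| lcmn m n)%N = (p ^ v %| m)%N || (p ^ v %| n)%N.
Proof.
by move=> pp m0 n0; rewrite !pfactor_dvdn ?lcmn_gt0 ?m0 // logn_lcm // leq_max.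
Qed.

Lemma pfactor_dvd_biglcm (I : finType) (F : I -> nat) p v :
    prime p -> (0 < v)%N -> (forall i, 0 < F i)%N ->
  (p ^ v %| \big[lcmn/1%N]_(i : I) F i)%N = [exists i, (p ^ v %| F i)%N].
Proof.
move=> pp v0 F0; have pv1 : (p ^ v == 1)%N = false.
  by rewrite -[X in (_ == X)](expn0 p) eqn_exp2l ?prime_gt1 //; lia.
suff /(_ (index_enum I)) [_ ->] : forall r : seq I,
    (0 < \big[lcmn/1%N]_(i <- r) F i)%N /\
    (p ^ v %| \big[lcmn/1%N]_(i <- r) F i)%N = has (fun i => (p ^ v %| F i)%N) r.
  by apply/hasP/existsP => [[i _]|[i]] h; exists i; rewrite ?mem_index_enum.
elim=> [|i r [IH0 IH]]; first by rewrite big_nil dvdn1 pv1.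
by rewrite big_cons lcmn_gt0 F0 IH0 /= pfactor_dvd_lcm // IH.
Qed.

Lemma sum_pfactor_dvd p n N : prime p -> (0 < n)%N -> (logn p n <= N)%N ->
  (\sum_(2 <= v < N.+1) (p ^ v %| n) = (logn p n).-1)%N.
Proof.
move=> pp n0 lN; under eq_bigr do rewrite pfactor_dvdn //.
have [l1|l1] := leqP (logn p n) 1.
  rewrite big_nat big1; first by case: (logn p n) l1 => [|[]].
  by move=> v /andP[v2 _]; case: leqP => //; lia.
have l2 : (2 <= (logn p n).+1)%N by lia.
have lN1 : ((logn p n).+1 <= N.+1)%N by lia.
rewrite (big_cat_nat l2 lN1) /=.
have -> : (\sum_(2 <= v < (logn p n).+1) (v <= logn p n) = (logn p n).-1)%N.
  rewrite -[RHS](_ : ((logn p n).+1 - 2) * 1 = _)%N; last by rewrite muln1; lia.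
  rewrite -sum_nat_const_nat; apply: eq_big_nat => v /andP[_ v2].
  by rewrite -ltnS v2.
rewrite big_nat big1 ?addn0 // => v /andP[v2 _].
by case: leqP => //; lia.
Qed.

(** Only exponents at least 2 contribute to B: the first factor p of each
    prime power is removed by A^*. *)
Lemma primesumBE n N : (0 < n)%N ->
    (forall p v, prime p -> (0 < v)%N -> (p ^ v %| n)%N -> (p ^ v <= N)%N) ->
  primesumB n =
  (\sum_(0 <= p < N.+1 | prime p) p * \sum_(2 <= v < N.+1) (p ^ v %| n))%N%:Z.
Proof.
move=> n0 H.
have lN p : prime p -> (logn p n <= N)%N.
  move=> pp; case: (posnP (logn p n)) => [->//|l0].
  apply: leq_trans (H p _ pp l0 (pfactor_dvdnn _ _)).
  by apply/ltnW/ltn_expl/prime_gt1.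
have E (F : nat -> nat) : (\sum_(p <- primes n) F p =
    \sum_(0 <= p < N.+1 | prime p) (if p \in primes n then F p else 0))%N.
  rewrite -big_mkcondr -[RHS]big_filter; apply: perm_big; apply: uniq_perm.
  - exact: primes_uniq.
  - by rewrite filter_uniq // iota_uniq.
  move=> p; rewrite mem_filter mem_index_iota mem_primes.
  apply/idP/idP => [/and3P[pp _ pn]|/andP[/andP[] //]].
  by rewrite pp n0 pn ltnS /= -(expn1 p) H // expn1.
rewrite /primesumB /primesumA /primesumAstar !E.
apply/eqP; rewrite subr_eq -PoszD eqz_nat -big_split /=; apply/eqP.
apply: eq_bigr => p pp; rewrite sum_pfactor_dvd ?lN //; case: ifP => [|].
  by rewrite -logn_gt0 mulnC; case: logn => //= l _; rewrite mulnS addnC.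
by rewrite -logn_gt0; case: logn => //= _; rewrite muln0.
Qed.

Lemma card_ord_pos N : #|[pred m : 'I_N.+1 | (0 < m)%N]| = N.
Proof.
transitivity #|predC1 (@ord0 N)|; last by rewrite cardC1 card_ord.
by apply: eq_card => -[[|m] mN].
Qed.

Lemma card_ord_pos_dvd q N :
  #|[pred m : 'I_N.+1 | (0 < m)%N && (q %| m)%N]| = (N %/ q)%N.
Proof.
rewrite divn_count_dvd -sum1_card big_mkcond /=.
rewrite big_ord_recl /= add0n big_add1 big_mkord; apply: eq_bigr => i _.
by rewrite inE /= /bump /= add1n; case: ifP.
Qed.

Lemma card_tuples_dvd k N q :
  (\sum_(n : {ffun 'I_k -> 'I_N.+1} | [forall i, 0 < n i])
     [exists i, q %| n i] = N ^ k - (N - N %/ q) ^ k)%N.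
Proof.
pose A := [pred m : 'I_N.+1 | (0 < m)%N].
pose B := [pred m : 'I_N.+1 | (0 < m)%N && ~~ (q %| m)%N].
have cA : (\sum_(n : {ffun 'I_k -> 'I_N.+1} | [forall i, 0 < n i]) 1 = N ^ k)%N.
  rewrite sum1_card -[in RHS](card_ord_pos N) -[in RHS](card_ord k) -card_ffun_on.
  by apply: eq_card => f; rewrite !inE.
have cB : (\sum_(n : {ffun 'I_k -> 'I_N.+1} | [forall i, 0 < n i])
     ~~ [exists i, q %| n i] = (N - N %/ q) ^ k)%N.
  have <- : #|B| = (N - N %/ q)%N.
    apply/esym/eqP; rewrite -(eqn_add2l (N %/ q)) subnKC ?leq_div //.
    rewrite -[X in X == _](card_ord_pos N) -(cardID [pred m : 'I_N.+1 | (q %| m)%N] A).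
    rewrite -card_ord_pos_dvd; apply/eqP; congr (_ + _)%N.
    by apply: eq_card => m; rewrite !inE andbC.
  rewrite -[in RHS](card_ord k) -card_ffun_on -sum1_card.
  rewrite [in RHS]big_mkcond [LHS]big_mkcond.
  apply: eq_bigr => f _; rewrite /= -[f \in _]/([forall i, B (f i)]).
  rewrite negb_exists; case: forallP => a; case: forallP => b; case: forallP => c //=.
  - by exfalso; apply: c => i; have /andP[] := b i.
  - by exfalso; apply: b => i; apply/andP; split; [exact: c|exact: a].
  - by exfalso; apply: a => i; have /andP[] := b i.
  - by exfalso; apply: a => i; have /andP[] := b i.
rewrite -cA -cB -sumnB; last by move=> f _; case: [exists _, _].
by apply: eq_bigr => f _; case: [exists _, _].
Qed.

(** Exchanging the sums: a prime power p^v divides the lcm exactly when it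
    divides one of the entries, and the tuples for which it divides none are
    counted coordinate by coordinate. *)
Lemma sum_B_lcmE (R : realType) k (x : R) : let N := Num.truncn x in
  sum_B_lcm k x = \sum_(0 <= p < N.+1 | prime p) p%:R *
    \sum_(2 <= v < N.+1) (N ^ k - (N - N %/ p ^ v) ^ k)%N%:R.
Proof.
move=> N; rewrite /sum_B_lcm -/N.
under eq_bigr => f /forallP f0.
  rewrite (@primesumBE _ N).
  - rewrite -pmulrn; over.
  - by rewrite /lcm_tuple; elim/big_ind: _ => // x1 x2 h1 h2; rewrite lcmn_gt0 h1.
  move=> p v pp v0; rewrite pfactor_dvd_biglcm // => /existsP[i /dvdn_leq].
  by move=> /(_ (f0 i)) /leq_trans; apply; rewrite -ltnS.
rewrite -natr_sum exchange_big /= natr_sum; apply: eq_bigr => p pp.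
rewrite -big_distrr /= natrM; congr (_ * _).
rewrite exchange_big /= natr_sum big_nat [RHS]big_nat; apply: eq_bigr => v /andP[v2 _].
congr _%:R; rewrite -card_tuples_dvd; apply: eq_bigr => f /forallP f0.
by rewrite pfactor_dvd_biglcm //; lia.
Qed.

(** * Elementary inequalities *)

Section Analysis.
Variable R : realType.
Implicit Types (a b x y : R) (u e f : nat -> R).

(** Comparing with a telescoping sum gives convergence together with its
    rate; Euler's constant, the prime series and Mertens' theorem all converge
    for this reason. *)
Lemma telescope_cvg u e n0 :
    (forall n, (n0 <= n)%N -> `|u n.+1 - u n| <= e n - e n.+1) ->
    (forall n, (n0 <= n)%N -> 0 <= e n) ->
  exists2 l, u @ \oo --> l & forall n, (n0 <= n)%N -> `|u n - l| <= e n.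
Proof.
move=> du e0.
have dm n d : (n0 <= n)%N -> `|u (n + d)%N - u n| <= e n - e (n + d)%N.
  move=> n0n; elim: d => [|d IH]; first by rewrite addn0 !subrr normr0.
  have := du (n + d)%N (leq_trans n0n (leq_addr _ _)).
  rewrite addnS; move: IH; rewrite !ler_norml; lra.
have cv (w : nat -> R) c : (forall n, (n0 <= n)%N -> w n.+1 <= w n) ->
    (forall n, (n0 <= n)%N -> c <= w n) -> cvgn w.
  move=> wd wc; have : cvgn [sequence w (i + n0)%N]_i.
    apply: nonincreasing_is_cvgn.
      apply/nonincreasing_seqP => i; rewrite /= addSn; apply: wd; lia.
    by exists c => _ [i _ <-] /=; apply: wc; lia.
  by case/cvg_ex => l /=; rewrite cvg_shiftn => wl; apply/cvg_ex; exists l.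
have ce : cvgn e.
  by apply: (cv _ 0) => // n /du; have := normr_ge0 (u n.+1 - u n); lra.
have cue : cvgn (fun n => u n + e n).
  apply: (cv _ (u n0 - e n0)) => n n0n.
    by have := du _ n0n; rewrite ler_norml; lra.
  have := dm _ (n - n0)%N (leqnn n0); rewrite subnKC // ler_norml.
  have := e0 _ n0n; lra.
have cu : u @ \oo --> limn (fun n => u n + e n) - limn e.
  have E : (fun n => u n + e n) - e = u by apply/funext => n; exact: addrK.
  by have /(_ _) := cvgB cue ce; rewrite E; apply.
exists (limn (fun n => u n + e n) - limn e) => // n n0n.
have cd : (fun m => `|u n - u m|) @ \oo -->
    `|u n - (limn (fun n => u n + e n) - limn e)|.
  by apply: cvg_norm; exact: (cvgB (cvg_cst _) cu).
rewrite -(cvg_lim _ cd) //; apply: limr_le; first exact: cvgP cd.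
exists n => // m /= nm; have := dm _ (m - n)%N n0n.
by rewrite subnKC // distrC; have := e0 m (leq_trans n0n nm); lra.
Qed.

Lemma ln_sub_le a b : 0 < a -> 0 < b -> ln b - ln a <= (b - a) / a.
Proof.
move=> a0 b0; rewrite -ln_div ?posrE //.
have -> : b / a = 1 + (b - a) / a by field; lra.
apply: le_ln1Dx; rewrite ltr_pdivlMr //; lra.
Qed.

Lemma ln_sub_ge a b : 0 < a -> 0 < b -> (b - a) / b <= ln b - ln a.
Proof.
move=> a0 b0; have := ln_sub_le b0 a0.
by rewrite -[a - b]opprB mulNr; lra.
Qed.

Lemma geometric_sum x m n : (m <= n)%N -> x != 1 ->
  \sum_(m <= v < n) x ^+ v = (x ^+ m - x ^+ n) / (1 - x).
Proof.
move=> mn x1; have x1' : 1 - x != 0 by rewrite subr_eq0 eq_sym.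
rewrite -(subnKC mn); elim: (n - m)%N => [|d IH].
  by rewrite addn0 big_geq // subrr mul0r.
by rewrite addnS big_nat_recr ?leq_addr //= IH exprS; field.
Qed.

Lemma natr_divn_le n d : (n %/ d)%:R <= n%:R / d%:R :> R.
Proof.
have [->|d0] := posnP d; first by rewrite divn0 invr0 mulr0.
by rewrite ler_pdivlMr ?ltr0n // -natrM ler_nat leq_divM.
Qed.

Lemma natr_divn_gt n d : (0 < d)%N -> n%:R / d%:R - 1 < (n %/ d)%:R :> R.
Proof.
move=> d0; rewrite ltrBlDr ltr_pdivrMr ?ltr0n // natr1 -natrM ltr_nat.
exact: ltn_ceil.
Qed.

End Analysis.

(** * Chebyshev and Mertens estimates *)

Section Mertens.
Variable R : realType.
Implicit Types (x y : R) (f g : nat -> R).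

Definition prime_sum f n := \sum_(0 <= p < n.+1 | prime p) f p.
Definition theta n := prime_sum (fun p => ln p%:R) n.
Definition sum_ln_prime n := prime_sum (fun p => ln p%:R / p%:R) n.
Definition sum_prime_inv n := prime_sum (fun p => p%:R^-1) n.

Lemma prime_sumS f n :
  prime_sum f n.+1 = prime_sum f n + (if prime n.+1 then f n.+1 else 0).
Proof. exact: big_nat_recr_cond. Qed.

Lemma prime_sum1 f : prime_sum f 1 = 0.
Proof. by rewrite /prime_sum /index_iota /= !big_cons big_nil. Qed.

Lemma le_prime_sum f g n :
  (forall p, prime p -> (p <= n)%N -> f p <= g p) -> prime_sum f n <= prime_sum g n.
Proof.
move=> fg; rewrite /prime_sum big_nat_cond [leRHS]big_nat_cond.
by apply: ler_sum => p /andP[/andP[_ pn] pp]; apply: fg.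
Qed.

Lemma prime_sum_ge0 f n : (forall p, prime p -> 0 <= f p) -> 0 <= prime_sum f n.
Proof. by move=> f0; apply: sumr_ge0 => p pp; exact: f0. Qed.

Lemma prime_ge2R p : prime p -> 2 <= p%:R :> R.
Proof. by move=> pp; rewrite ler_nat prime_gt1. Qed.

Lemma ln_prime_gt0 p : prime p -> 0 < ln p%:R :> R.
Proof. by move=> /prime_ge2R p2; apply: ln_gt0; lra. Qed.

Lemma ln_prod (I : Type) (r : seq I) (P : pred I) (F : I -> R) :
  (forall i, P i -> 0 < F i) ->
  ln (\prod_(i <- r | P i) F i) = \sum_(i <- r | P i) ln (F i).
Proof.
move=> F0; suff [_ ->//] : 0 < \prod_(i <- r | P i) F i /\
    ln (\prod_(i <- r | P i) F i) = \sum_(i <- r | P i) ln (F i).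
apply: (big_ind2 (fun a b => 0 < a /\ ln a = b)) => [|a b c d|i Pi].
- by rewrite ltr01 ln1.
- by move=> [a0 <-] [c0 <-]; rewrite mulr_gt0 // lnM ?posrE.
by split; rewrite ?F0.
Qed.

Lemma theta_le n : theta n <= 3 * n%:R.
Proof.
have -> : theta n = ln (\prod_(0 <= p < n.+1 | prime p) p)%:R.
  by rewrite natr_prod ln_prod // => p /prime_gt0; rewrite ltr0n.
have : ln (\prod_(0 <= p < n.+1 | prime p) p)%:R <= ln (4 ^+ n) :> R.
  rewrite ler_ln ?posrE ?exprn_gt0 //; first by rewrite -natrX ler_nat primorial_le.
  by rewrite ltr0n prodn_cond_gt0 // => p /prime_gt0.
move=> /le_trans; apply; rewrite lnXn // -(mulr_natr (ln 4)) ler_wpM2r //.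
have := @ln_sub_le R 1 4 ltr01 (ltr0n _ 4); rewrite ln1; lra.
Qed.

Lemma ln_sum_logn m N : (0 < m <= N)%N ->
  ln m%:R = prime_sum (fun p => (logn p m)%:R * ln p%:R) N.
Proof.
move=> /andP[m0 mN]; rewrite -{1}(partnT m0) /partn natr_prod ln_prod; last first.
  by move=> p; rewrite ltr0n expn_gt0; case: p.
rewrite /prime_sum (@big_cat_nat _ _ _ m.+1 0 N.+1) //= [X in _ + X]big_nat_cond.
rewrite [X in _ + X]big1 ?addr0.
  rewrite [RHS]big_mkcond [LHS]big_mkcond /=; apply: eq_bigr => p _.
  case: ifP => [pp|/negbT np].
    by rewrite natrX lnXn ?ltr0n ?prime_gt0 // mulr_natl.
  by rewrite /logn (negbTE np) expn0 ln1.
move=> p /andP[/andP[mp _] pp]; rewrite lognE pp m0 /=.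
by case: ifP => [/(dvdn_leq m0)|]; [lia|rewrite mul0r].
Qed.

Lemma ln_fact_logn n :
  ln n`!%:R = prime_sum (fun p => (logn p n`!)%:R * ln p%:R) n.
Proof.
suff H m : (m <= n)%N -> ln m`!%:R = prime_sum (fun p => (logn p m`!)%:R * ln p%:R) n.
  exact: H.
elim: m => [|m IH] mn.
  by rewrite fact0 ln1 /prime_sum big1 // => p _; rewrite logn1 mul0r.
rewrite factS natrM lnM ?posrE ?ltr0n ?fact_gt0 // IH; last exact: ltnW.
rewrite (@ln_sum_logn m.+1 n) // /prime_sum -big_split /=; apply: eq_bigr => p pp.
by rewrite lognM ?fact_gt0 // natrD mulrDl.
Qed.

Lemma logn_fact_ge p n : prime p -> (0 < n)%N ->
  n%:R / p%:R - 1 <= (logn p n`!)%:R :> R.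
Proof.
move=> pp n0; rewrite logn_fact // big_ltn ?ltnS // expn1 natrD.
apply: le_trans (ltW (natr_divn_gt R n (prime_gt0 pp))) _.
by rewrite lerDl.
Qed.

Lemma logn_fact_le p n : prime p -> (logn p n`!)%:R <= n%:R / (p%:R - 1) :> R.
Proof.
move=> pp; have p2 := prime_ge2R pp; rewrite logn_fact // natr_sum.
have -> : n%:R / (p%:R - 1) = n%:R * (p%:R^-1 / (1 - p%:R^-1)) :> R.
  by field; apply/andP; split; lra.
apply: (@le_trans _ _ (\sum_(1 <= k < n.+1) n%:R * p%:R^-1 ^+ k)).
  by apply: ler_sum => k _; rewrite exprVn -natrX; exact: natr_divn_le.
have p1 : p%:R^-1 < 1 :> R by rewrite invf_lt1; lra.
have p0 : 0 < p%:R^-1 :> R by rewrite invr_gt0; lra.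
rewrite -big_distrr /= ler_wpM2l // geometric_sum //; last by rewrite lt_eqF.
rewrite ler_pM2r ?invr_gt0; last by lra.
by rewrite expr1; have := exprn_ge0 n.+1 (ltW p0); lra.
Qed.

Lemma ln_fact_le n : ln n`!%:R <= n%:R * ln n%:R :> R.
Proof.
elim: n => [|n IH]; first by rewrite fact0 ln1 mul0r.
rewrite factS natrM lnM ?posrE ?ltr0n ?fact_gt0 //.
rewrite -[X in _ <= X * _]natr1 mulrDl mul1r addrC lerD2r.
apply: le_trans IH _; rewrite ler_wpM2l //.
case: n => [|n]; first by rewrite ln0 // ln_ge0.
by rewrite ler_ln ?posrE ?ltr0n // ler_nat.
Qed.

Lemma ln_fact_ge n : n%:R * ln n%:R - n%:R <= ln n`!%:R :> R.
Proof.
elim: n => [|n IH]; first by rewrite fact0 ln1 mul0r subr0.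
rewrite factS natrM lnM ?posrE ?ltr0n ?fact_gt0 //.
suff : n%:R * (ln n.+1%:R - ln n%:R) <= 1 :> R by rewrite -!natr1; move: IH; lra.
case: n {IH} => [|n]; first by rewrite mul0r.
have n0 : 0 < n.+1%:R :> R by rewrite ltr0n.
rewrite -[leRHS](mulfV (lt0r_neq0 n0)) ler_wpM2l //.
have -> : n.+1%:R^-1 = (n.+2%:R - n.+1%:R) / n.+1%:R :> R.
  by rewrite -(natr1 n.+1) addrAC subrr add0r mul1r.
by apply: ln_sub_le; rewrite ltr0n.
Qed.

(** The terms with index m are bounded by the increments of
    - ln m / m - 1 / (m - 1). *)
Lemma prime_sum_ln_le n : prime_sum (fun p => ln p%:R / (p%:R * (p%:R - 1))) n <= 2.
Proof.
suff H m : prime_sum (fun p => ln p%:R / (p%:R * (p%:R - 1))) m.+2 <=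
    2 - ln m.+2%:R / m.+2%:R - m.+1%:R^-1.
  case: n => [|[|n]]; rewrite ?prime_sum1 ?ler0n //.
    by rewrite /prime_sum big_ltn_cond // big_geq.
  apply: le_trans (H n) _; rewrite -addrA -opprD gerBl addr_ge0 ?invr_ge0 //.
  by rewrite divr_ge0 // ln_ge0 // ler1n.
elim: m => [|m IH].
  rewrite prime_sumS prime_sum1 /= add0r invr1 (_ : 2 - 1 = 1) ?mulr1; last by lra.
  by have := @ln_sub_le R 1 2 ltr01 (ltr0n _ 2); rewrite ln1; lra.
apply: (@le_trans _ _ (prime_sum (fun p => ln p%:R / (p%:R * (p%:R - 1))) m.+2
                       + ln m.+3%:R / (m.+3%:R * (m.+3%:R - 1)))).
  by rewrite prime_sumS lerD2l; case: ifP => // _; rewrite divr_ge0 ?ln_ge0 ?ler1n //.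
have : ln m.+3%:R - ln m.+2%:R <= (m.+3%:R - m.+2%:R) / m.+2%:R :> R.
  by apply: ln_sub_le; rewrite ltr0n.
move: IH; move: (ln m.+3%:R : R) (ln m.+2%:R : R) => b a.
rewrite -!natr1; have : 0 <= m%:R :> R by [].
move: (m%:R : R) => t t0 IH ab.
have -> : b / ((t + 1 + 1 + 1) * (t + 1 + 1 + 1 - 1)) =
    b / (t + 1 + 1) - b / (t + 1 + 1 + 1) by field; do ?[apply/andP; split]; lra.
have ab' : b / (t + 1 + 1) <= a / (t + 1 + 1) + (t + 1 + 1)^-1 ^+ 2.
  have -> : a / (t + 1 + 1) + (t + 1 + 1)^-1 ^+ 2 =
      (a + (t + 1 + 1 + 1 - (t + 1 + 1)) / (t + 1 + 1)) / (t + 1 + 1) by field; lra.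
  by rewrite ler_pM2r ?invr_gt0; lra.
have : (t + 1 + 1)^-1 ^+ 2 <= (t + 1)^-1 - (t + 1 + 1)^-1.
  have -> : (t + 1)^-1 - (t + 1 + 1)^-1 = (t + 1)^-1 * (t + 1 + 1)^-1.
    by field; apply/andP; split; lra.
  by rewrite expr2 ler_pM2r ?invr_gt0 ?lef_pV2 ?posrE; lra.
lra.
Qed.

(** Mertens' first theorem: the exponent of p in n! is n/p up to an error
    whose total is controlled by theta and [prime_sum_ln_le], while
    ln n! = n ln n + O(n). *)
Lemma mertens_first n : (0 < n)%N -> `|sum_ln_prime n - ln n%:R| <= 3.
Proof.
move=> n0; have n0R : 0 < n%:R :> R by rewrite ltr0n.
have lo : n%:R * sum_ln_prime n - theta n <= ln n`!%:R.
  rewrite ln_fact_logn /sum_ln_prime /theta /prime_sum big_distrr /= -sumrB.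
  apply: ler_sum => p pp.
  rewrite (_ : _ - _ = (n%:R / p%:R - 1) * ln p%:R); last by ring.
  by rewrite ler_wpM2r ?logn_fact_ge // ltW // ln_prime_gt0.
have hi : ln n`!%:R <= n%:R * (sum_ln_prime n + 2).
  rewrite ln_fact_logn; apply: (@le_trans _ _ (n%:R * (sum_ln_prime n +
      prime_sum (fun p => ln p%:R / (p%:R * (p%:R - 1))) n))); last first.
    by rewrite ler_pM2l // lerD2l prime_sum_ln_le.
  rewrite /sum_ln_prime /prime_sum -big_split big_distrr /=; apply: ler_sum => p pp.
  have p2 := prime_ge2R pp.
  rewrite (_ : n%:R * _ = n%:R / (p%:R - 1) * ln p%:R); last first.
    by field; apply/andP; split; lra.
  by rewrite ler_wpM2r ?logn_fact_le // ltW // ln_prime_gt0.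
have h1 : n%:R * (sum_ln_prime n - ln n%:R) <= n%:R * 3.
  by have := theta_le n; have := ln_fact_le n; lra.
have h2 : n%:R * (- 3) <= n%:R * (sum_ln_prime n - ln n%:R).
  by have := ln_fact_ge n; lra.
by move: h1 h2; rewrite !ler_pM2l // ler_norml => -> ->.
Qed.

(** Partial summation from [mertens_first]: once the boundary term r / ln n is
    subtracted, the increments are dominated by those of 1 / ln n. *)
Lemma mertens_second : exists M, forall n, (2 <= n)%N ->
  `|sum_prime_inv n - ln (ln n%:R) - M| <= 7 / ln n%:R.
Proof.
pose r n := sum_ln_prime n - ln n%:R.
pose V n := sum_prime_inv n - ln (ln n%:R) - r n / ln n%:R.
have L0 n : (2 <= n)%N -> 0 < ln n%:R :> R by move=> n2; rewrite ln_gt0 // ltr1n.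
have [n n2|n n2|M _ VM] := @telescope_cvg _ V (fun n => 4 / ln n%:R) 2.
- have L1 := L0 n n2; have L2 := L0 n.+1 (ltnW n2).
  have rn : `|r n| <= 3 by apply: mertens_first; lia.
  have dS : sum_prime_inv n.+1 - sum_prime_inv n =
      (sum_ln_prime n.+1 - sum_ln_prime n) / ln n.+1%:R.
    rewrite /sum_prime_inv /sum_ln_prime !prime_sumS; case: ifP => _.
      by rewrite !(addrAC _ _ (- _)) !subrr !add0r mulrAC mulfV ?mul1r ?lt0r_neq0.
    by ring.
  have n0 : 0 < n%:R :> R by rewrite ltr0n; lia.
  have dL : ln n.+1%:R - ln n%:R <= 1 :> R.
    have := @ln_sub_le R n%:R n.+1%:R n0; rewrite ltr0n => /(_ erefl) /le_trans; apply.
    rewrite ler_pdivrMr // mul1r -natr1; have : 1 <= n%:R :> R by rewrite ler1n; lia.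
    lra.
  have L12 : ln n%:R <= ln n.+1%:R :> R by rewrite ler_ln ?posrE ?ltr0n ?ler_nat; lia.
  have := ln_sub_le L1 L2; have := ln_sub_ge L1 L2.
  rewrite /V; move: dS; rewrite (_ : sum_ln_prime n.+1 - sum_ln_prime n =
    (r n.+1 - r n) + (ln n.+1%:R - ln n%:R)); last by rewrite /r; ring.
  move: (ln (ln n.+1%:R)) (ln (ln n%:R)) => B A.
  move: (sum_prime_inv n.+1) (sum_prime_inv n).
  move: (r n) rn (r n.+1) L1 L2 dL L12 => r0 r0b r1.
  move: (ln n%:R : R) (ln n.+1%:R : R) => L L' L1 L2 dL L12 P' P dP lo hi.
  have -> : P' - B - r1 / L' - (P - A - r0 / L) =
      ((L' - L) / L' - (B - A)) + r0 * (L^-1 - L'^-1).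
    by rewrite (_ : P' = P + (P' - P)); [rewrite dP; field; lra|ring].
  have dI : 0 <= L^-1 - L'^-1 by rewrite subr_ge0 lef_pV2 ?posrE.
  have h1 : (L' - L) / L - (L' - L) / L' <= L^-1 - L'^-1.
    rewrite -mulrBr -[leRHS]mul1r; exact: ler_wpM2r.
  have h2 : `|r0 * (L^-1 - L'^-1)| <= 3 * (L^-1 - L'^-1).
    by rewrite normrM (ger0_norm dI) ler_wpM2r.
  rewrite -mulrBr; apply: le_trans (ler_normD _ _) _.
  have : `|(L' - L) / L' - (B - A)| <= L^-1 - L'^-1 by rewrite ler_norml; lra.
  by move: h2; lra.
- by rewrite divr_ge0 // ltW // L0.
exists M => n n2; have := VM n n2; have L1 := L0 n n2.
have rn : `|r n / ln n%:R| <= 3 / ln n%:R.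
  by rewrite normrM normfV (gtr0_norm L1) ler_pM2r ?invr_gt0 //; apply: mertens_first; lia.
rewrite /V => h; rewrite (_ : _ - M = (sum_prime_inv n - ln (ln n%:R) - r n / ln n%:R - M)
   + r n / ln n%:R); last by ring.
apply: le_trans (ler_normD _ _) _; apply: le_trans (lerD h rn) _; lra.
Qed.

End Mertens.

(** * The logarithmic series *)

Section LogSeries.
Variable R : realType.

Lemma is_derive_log_series N (t : R) :
  is_derive t 1 (fun x : R => \sum_(0 <= m < N) x ^+ m.+1 / m.+1%:R)
    (\sum_(0 <= m < N) t ^+ m).
Proof.
elim: N => [|N IH].
  rewrite big_geq // (_ : (fun _ => _) = cst 0); first exact: is_derive_cst.
  by apply/funext => x; rewrite big_geq.
rewrite (_ : (fun _ => _) = (fun x : R => \sum_(0 <= m < N) x ^+ m.+1 / m.+1%:R)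
   + (fun x : R => x ^+ N.+1 / N.+1%:R)); last first.
  by apply/funext => x; rewrite big_nat_recr.
rewrite big_nat_recr //=; apply: is_deriveD.
have -> : (fun x : R => x ^+ N.+1 / N.+1%:R) = N.+1%:R^-1 *: (id ^+ N.+1 : R -> R).
  by apply/funext => x; rewrite /= mulrC exprfctE.
apply: is_derive_eq.
rewrite /GRing.scale /= mulr1 -mulr_natl mulrA mulVf ?mul1r //.
Qed.

(** The remainder has derivative t^N / (1 - t), which lies between 0 and
    z^N / (1 - z) on [0, z]. *)
Lemma log_series (z : R) N : 0 < z < 1 ->
  0 <= - ln (1 - z) - \sum_(0 <= m < N) z ^+ m.+1 / m.+1%:R <= z ^+ N / (1 - z).
Proof.
move=> /andP[z0 z1].
pose f (x : R) := - ln (1 - x) - \sum_(0 <= m < N) x ^+ m.+1 / m.+1%:R.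
have df (x : R) : x < 1 -> is_derive x 1 f (x ^+ N / (1 - x)).
  move=> x1.
  have -> : x ^+ N / (1 - x) = (1 - x)^-1 - \sum_(0 <= m < N) x ^+ m.
    rewrite geometric_sum // ?expr0; last by rewrite lt_eqF.
    by rewrite mulrBl mul1r opprB addrCA subrr addr0.
  apply: is_deriveB; last exact: is_derive_log_series.
  rewrite -[X in is_derive _ _ _ X]opprK; apply: is_deriveN.
  have H1 : is_derive (1 - x) 1 (@ln R) (1 - x)^-1 by apply: is_derive1_ln; lra.
  have H2 : is_derive x 1 (fun y : R => 1 - y) (-1).
    by apply: is_derive_eq; rewrite add0r mul1r.
  by have := @is_derive1_comp _ (@ln R) (fun y : R => 1 - y) _ _ _ H1 H2; rewrite mulrN1.
have dfz (x : R) : x \in `]0, z[ -> is_derive x 1 f (x ^+ N / (1 - x)).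
  by rewrite in_itv /= => /andP[_ xz]; apply: df; apply: lt_trans z1.
have cf : {within `[0, z], continuous f}.
  apply: derivable_within_continuous => x; rewrite in_itv /= => /andP[_ xz].
  by have [] := df x (le_lt_trans xz z1).
have [c] := MVT z0 dfz cf; rewrite in_itv /= => /andP[c0 cz].
have -> : f 0 = 0.
  by rewrite /f subr0 ln1 big1 ?subr0 ?oppr0 // => m _; rewrite expr0n mul0r.
rewrite subr0 subr0 -/(f z) => ->.
have c1 : 0 < 1 - c by lra.
have cN : c ^+ N <= z ^+ N by rewrite lerXn2r ?nnegrE // ltW.
have zi : 0 < 1 - z by lra.
have c0' := ltW c0.
have q0 : 0 <= c ^+ N / (1 - c) by rewrite divr_ge0 ?exprn_ge0 // ltW.
apply/andP; split; first by rewrite mulr_ge0 // ltW.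
apply: (@le_trans _ _ (c ^+ N / (1 - c))).
  by rewrite -[leRHS]mulr1 ler_wpM2l // ltW.
apply: ler_pM => //; rewrite ?exprn_ge0 ?invr_ge0 ?lef_pV2 ?posrE //; lra.
Qed.
End LogSeries.

(** * The Euler product *)

Section EulerProduct.
Variable R : realType.

Definition rough y n := \big[andb/true]_(0 <= p < y.+1 | prime p) ~~ (p %| n)%N.

Lemma roughS y n :
  rough y.+1 n = rough y n && (prime y.+1 ==> ~~ (y.+1 %| n)%N).
Proof. by rewrite /rough big_nat_recr_cond /=; case: ifP. Qed.

Lemma roughM y p m : prime p -> (y < p)%N -> rough y (p * m) = rough y m.
Proof.
move=> pp yp; rewrite /rough big_nat_cond [RHS]big_nat_cond.
apply: eq_bigr => q /andP[/andP[_ qy] pq].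
rewrite Euclid_dvdM // dvdn_prime2 //; case: eqP => // E; move: qy; rewrite E; lia.
Qed.

Lemma rough1 y : rough y 1.
Proof.
rewrite /rough big1 // => p pp; rewrite dvdn1.
by case: eqP pp => // ->.
Qed.

Lemma rough_eq1 y n : (0 < n <= y)%N -> rough y n = (n == 1%N).
Proof.
move=> /andP[n0 ny]; case: eqP => [->|n1]; first exact: rough1.
have n2 : (1 < n)%N by lia.
have := pdiv_dvd n; have := pdiv_prime n2; have := pdiv_leq n0.
move: (pdiv n) => p pn pp pdn.
rewrite /rough big_mkcond (bigD1_seq p) ?mem_index_iota ?iota_uniq //=; last by lia.
by rewrite pp pdn.
Qed.

Lemma sum_multiples (F : nat -> R) (P : pred nat) p N : (0 < p)%N ->
  \sum_(1 <= n < N.+1 | P n && (p %| n)%N) F n =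
  \sum_(1 <= m < (N %/ p).+1 | P (p * m)%N) F (p * m)%N.
Proof.
move=> p0; elim: N => [|N IH]; first by rewrite div0n !big_geq.
rewrite big_mkcond big_nat_recr //= -big_mkcond IH divnS //.
case: (boolP (p %| N.+1)%N) => pN; rewrite ?andbF ?andbT ?addr0 //.
rewrite add1n [RHS]big_mkcond big_nat_recr //= -big_mkcond.
suff -> : (p * (N %/ p).+1)%N = N.+1 by [].
by rewrite -[RHS](divnK pN) divnS // pN add1n mulnC.
Qed.

Variable g : nat -> R.
Hypothesis g0 : forall n, (0 < n)%N -> 0 < g n.
Hypothesis g1 : g 1 = 1.
Hypothesis gM : forall m n, (0 < m)%N -> (0 < n)%N -> g (m * n) = g m * g n.

Definition rough_sum y N := \sum_(1 <= n < N.+1 | rough y n) g n.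

Lemma rough_sum_le y M N : (M <= N)%N -> rough_sum y M <= rough_sum y N.
Proof.
move=> MN; rewrite /rough_sum [leRHS](@big_cat_nat _ _ _ M.+1) //=.
rewrite lerDl big_nat_cond sumr_ge0 // => n /andP[/andP[n1 _] _].
by apply: ltW; apply: g0; lia.
Qed.

(** The multiples of the prime p = y + 1 among the integers free of smaller
    primes are p times such integers. *)
Lemma rough_sumS y N : rough_sum y N = rough_sum y.+1 N +
  (if prime y.+1 then g y.+1 * rough_sum y (N %/ y.+1) else 0).
Proof.
rewrite {2}/rough_sum; under eq_bigl do rewrite roughS.
case: ifP => pp; last first.
  by rewrite addr0; apply: eq_bigl => n; rewrite andbT.
rewrite addrC {1}/rough_sum (bigID (fun n => y.+1 %| n)%N) /=; congr (_ + _).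
rewrite sum_multiples // /rough_sum big_distrr /=.
rewrite big_nat_cond [RHS]big_nat_cond; apply: eq_big => [m|m].
  by rewrite roughM.
by move=> /andP[/andP[m1 _] _]; rewrite gM.
Qed.

Lemma rough_sum_diag N : (0 < N)%N -> rough_sum N N = 1.
Proof.
move=> N0; rewrite /rough_sum big_mkcond big_ltn // rough1 g1 big_nat big1 /= ?addr0 //.
move=> n /andP[n2 nN]; rewrite rough_eq1; last by lia.
by case: eqP => //; lia.
Qed.

Definition zeta_sum N := \sum_(1 <= n < N.+1) g n.
Definition euler_prod y := \prod_(0 <= p < y.+1 | prime p) (1 - g p).

Lemma rough_sum0 N : rough_sum 0 N = zeta_sum N.
Proof.
apply: eq_bigl => n; rewrite /rough /index_iota /= big_cons big_nil //.
Qed.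

Hypothesis gp1 : forall p, prime p -> g p < 1.

Lemma euler_prod_gt0 y : 0 < euler_prod y.
Proof. by apply: prodr_gt0 => p pp; rewrite subr_gt0 gp1. Qed.

(** Removing the multiples of one more prime p leaves at least the fraction
    1 - g p of a truncated sum; once all primes up to N are removed, only the
    term n = 1 survives. *)
Lemma euler_prod_zeta_le N : (0 < N)%N -> euler_prod N * zeta_sum N <= 1.
Proof.
move=> N0; rewrite -(rough_sum_diag N0).
suff H y : euler_prod y * zeta_sum N <= rough_sum y N by exact: H.
elim: y => [|y IH].
  rewrite /euler_prod /index_iota /= big_cons big_nil /= mul1r.
  by rewrite rough_sum0.
have := rough_sumS y N; rewrite /euler_prod big_nat_recr_cond -/(euler_prod y) /=.
case: ifP => pp; last by rewrite mulr1 addr0 => <-.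
have := rough_sum_le y (leq_div N y.+1); have := gp1 pp; have := g0 (ltn0Sn y).
rewrite mulrAC; move: IH; nra.
Qed.

(** Conversely, for the sums over all integers at most the fraction 1 - g p is
    left. Suprema stand for these infinite sums; whatever primes are removed,
    the term g 1 = 1 remains. *)
Lemma euler_prod_zeta_ge B y : (forall N, zeta_sum N <= B) ->
  1 <= euler_prod y * B.
Proof.
move=> zB.
suff [c cB cN] : exists2 c, c <= euler_prod y * B & forall N, rough_sum y N <= c.
  apply: le_trans cB; apply: le_trans (cN 1%N).
  by rewrite /rough_sum big_mkcond big_nat1 rough1 g1.
elim: y => [|y [c cB cN]].
  exists B; last by move=> N; rewrite rough_sum0.
  by rewrite /euler_prod /index_iota /= big_cons big_nil /= mul1r.
rewrite /euler_prod big_nat_recr_cond -/(euler_prod y) /=.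
case: ifP => pp; last first.
  exists c; rewrite ?mulr1 // => N; move: (cN N).
  by rewrite (rough_sumS y N) pp addr0.
pose S : set R := range (rough_sum y).
have S0 : S !=set0 by exists (rough_sum y 0), 0%N.
have hS : has_sup S by split => //; exists c => _ [N _ <-].
have gp := g0 (ltn0Sn y).
exists ((1 - g y.+1) * sup S).
  rewrite mulrAC mulrC ler_wpM2r ?subr_ge0 ?(ltW (gp1 pp)) //.
  by apply: le_trans cB; apply: ge_sup => // _ [N _ <-].
move=> N; have up M : rough_sum y M <= sup S by apply: sup_upper_bound => //; exists M.
suff : sup S <= (sup S - rough_sum y.+1 N) / g y.+1.
  by rewrite ler_pdivlMr //; lra.
apply: ge_sup => // _ [M _ <-]; rewrite ler_pdivlMr // mulrC.
have := up (maxn N (M * y.+1)); rewrite rough_sumS pp.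
have := rough_sum_le y.+1 (leq_maxl N (M * y.+1)).
have : (M <= maxn N (M * y.+1) %/ y.+1)%N.
  by rewrite leq_divRL // leq_maxr.
move=> /(rough_sum_le y); rewrite -(ler_pM2l gp); lra.
Qed.

End EulerProduct.

(** * Sums over primes near the pole of zeta *)

Section PrimeZeta.
Variables (R : realType) (d : R).
Hypothesis d0 : 0 < d.

(** This is n^(-d), so that [zterm n] is n^(-1-d). *)
Definition damp n : R := expR (- d * ln n%:R).
Definition zterm n : R := n%:R^-1 * damp n.

Lemma damp_gt0 n : 0 < damp n. Proof. exact: expR_gt0. Qed.

Lemma damp1 : damp 1 = 1. Proof. by rewrite /damp ln1 mulr0 expR0. Qed.

Lemma dampM m n : (0 < m)%N -> (0 < n)%N -> damp (m * n) = damp m * damp n.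
Proof.
move=> m0 n0; rewrite /damp natrM lnM ?posrE ?ltr0n // mulrDr expRD //.
Qed.

Lemma dampX m n : (0 < m)%N -> damp (m ^ n) = damp m ^+ n.
Proof.
move=> m0; elim: n => [|n IH]; first by rewrite expn0 damp1.
by rewrite expnS dampM ?expn_gt0 ?m0 // IH exprS.
Qed.

Lemma le_damp m n : (0 < m <= n)%N -> damp n <= damp m.
Proof.
move=> /andP[m0 mn]; rewrite ler_expR !mulNr lerN2 ler_wpM2l ?(ltW d0) //.
by rewrite ler_ln ?posrE ?ltr0n ?ler_nat //; lia.
Qed.

Lemma damp_ge n : 1 - d * ln n%:R <= damp n.
Proof. by rewrite /damp mulNr; exact: expR_ge1Dx. Qed.

Lemma damp_le1 n : (0 < n)%N -> damp n <= 1.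
Proof. by move=> n0; rewrite -damp1; apply: le_damp. Qed.

Lemma dampS_ge n : (0 < n)%N -> damp n - damp n.+1 <= d * zterm n.
Proof.
move=> n0; have n0R : 0 < n%:R :> R by rewrite ltr0n.
have -> : damp n.+1 = damp n * expR (- d * (ln n.+1%:R - ln n%:R)).
  by rewrite /damp -expRD; congr expR; ring.
have : 1 - d * n%:R^-1 <= expR (- d * (ln n.+1%:R - ln n%:R)).
  apply: le_trans (expR_ge1Dx _); rewrite mulNr lerD2l lerN2 ler_wpM2l ?(ltW d0) //.
  apply: le_trans (ln_sub_le n0R _) _; rewrite ?ltr0n //.
  by rewrite -natr1 addrAC subrr add0r mul1r.
rewrite /zterm -(ler_pM2l (damp_gt0 n)); lra.
Qed.

Lemma dampS_le n : (0 < n)%N -> d * zterm n.+1 <= damp n - damp n.+1.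
Proof.
move=> n0; have n0R : 0 < n%:R :> R by rewrite ltr0n.
have -> : damp n = damp n.+1 * expR (d * (ln n.+1%:R - ln n%:R)).
  by rewrite /damp -expRD; congr expR; ring.
have : 1 + d * n.+1%:R^-1 <= expR (d * (ln n.+1%:R - ln n%:R)).
  apply: le_trans (expR_ge1Dx _); rewrite lerD2l ler_wpM2l ?(ltW d0) //.
  apply: le_trans (ln_sub_ge n0R _); rewrite ?ltr0n //.
  by rewrite -natr1 addrAC subrr add0r mul1r.
rewrite /zterm -(ler_pM2l (damp_gt0 n.+1)).
by move: (n.+1%:R^-1 : R) (expR _) (damp _) => i e D; lra.
Qed.

(** The increments of - n^(-d) / d enclose the terms n^(-1-d). *)
Lemma zeta_sum_bounds N :
  (1 - damp N.+1) / d <= zeta_sum zterm N <= 1 + d^-1.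
Proof.
have t1 : zterm 1 = 1 by rewrite /zterm damp1 invr1 mulr1.
apply/andP; split.
  rewrite ler_pdivrMr // -damp1 mulrC; elim: N => [|N IH].
    by rewrite subrr /zeta_sum big_geq // mulr0.
  rewrite /zeta_sum big_nat_recr //= -/(zeta_sum _ N) mulrDr.
  by have := @dampS_ge N.+1 erefl; lra.
case: N => [|N]; first by rewrite /zeta_sum big_geq // addr_ge0 // invr_ge0 ltW.
suff H : d * zeta_sum zterm N.+1 <= d + (1 - damp N.+1).
  rewrite -(ler_pM2l d0) mulrDr mulfV ?lt0r_neq0 // mulr1.
  by have := damp_gt0 N.+1; lra.
elim: N => [|N IH]; first by rewrite /zeta_sum big_nat1 t1 damp1; lra.
rewrite /zeta_sum big_nat_recr //= -/(zeta_sum _ N.+1) mulrDr.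
by have := @dampS_le N.+1 erefl; lra.
Qed.

Lemma zterm_gt0 n : (0 < n)%N -> 0 < zterm n.
Proof. by move=> n0; rewrite mulr_gt0 ?damp_gt0 // invr_gt0 ltr0n. Qed.

Lemma zterm_le n : (0 < n)%N -> zterm n <= n%:R^-1.
Proof.
by move=> n0; rewrite -[leRHS]mulr1 ler_wpM2l ?damp_le1.
Qed.

Lemma inv_prime_le p : prime p -> 0 < (p%:R^-1 : R) <= 2^-1.
Proof.
move=> pp; have p2 := prime_ge2R R pp.
by rewrite invr_gt0 lef_pV2 ?posrE; lra.
Qed.

Lemma zterm_prime_lt1 p : prime p -> zterm p < 1.
Proof.
move=> pp; have /andP[_ p2] := inv_prime_le pp.
by have := zterm_le (prime_gt0 pp); lra.
Qed.

Lemma sum_ln_zterm y : (0 < y)%N ->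
  ln ((1 - damp y.+1) / d) <= prime_sum (fun p => - ln (1 - zterm p)) y <= ln (1 + d^-1).
Proof.
move=> y0; have ep0 := euler_prod_gt0 zterm_prime_lt1 y.
have -> : prime_sum (fun p => - ln (1 - zterm p)) y = ln (euler_prod zterm y)^-1.
  rewrite lnV ?posrE // /euler_prod ln_prod -?sumrN //.
  by move=> p /zterm_prime_lt1; rewrite subr_gt0.
have t1 : zterm 1 = 1 by rewrite /zterm damp1 invr1 mulr1.
have tM m n : (0 < m)%N -> (0 < n)%N -> zterm (m * n) = zterm m * zterm n.
  by move=> m0 n0; rewrite /zterm natrM invfM dampM // mulrACA.
have d1 : damp y.+1 < 1.
  by rewrite -expR0 ltr_expR mulNr oppr_lt0 mulr_gt0 // ln_gt0 // ltr1n.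
have D0 : 0 < 1 + d^-1 by rewrite addr_gt0 // invr_gt0.
rewrite !ler_ln ?posrE ?invr_gt0 ?divr_gt0 ?subr_gt0 //; apply/andP; split.
  have /andP[h _] := zeta_sum_bounds y; apply: le_trans h _.
  rewrite -[leRHS]mulr1 ler_pdivlMl //.
  exact: (euler_prod_zeta_le zterm_gt0 t1 tM zterm_prime_lt1).
rewrite -[leLHS]mulr1 ler_pdivrMl //.
apply: (euler_prod_zeta_ge zterm_gt0 t1 tM zterm_prime_lt1) => N.
by have /andP[] := zeta_sum_bounds N.
Qed.

Lemma ln1_sub_bounds (s t : R) : 0 < t <= s -> s <= 2^-1 ->
  0 <= (- ln (1 - s) - s) - (- ln (1 - t) - t) <= 2 * (s * (s - t)).
Proof.
move=> /andP[t0 ts] s2.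
have s1 : 0 < 1 - s by lra.
have t1 : 0 < 1 - t by lra.
have e : 1 - t - (1 - s) = s - t by ring.
have h1 : (s - t) / (1 - t) <= ln (1 - t) - ln (1 - s).
  by rewrite -e; exact: ln_sub_ge.
have h2 : ln (1 - t) - ln (1 - s) <= (s - t) / (1 - s).
  by rewrite -e; exact: ln_sub_le.
have st : 0 <= s - t by lra.
have h3 : s - t <= (s - t) / (1 - t).
  by rewrite ler_pdivlMr //; have := mulr_ge0 st (ltW t0); lra.
have h4 : (s - t) / (1 - s) <= (s - t) + 2 * (s * (s - t)).
  have s0 : 0 <= s * (1 - 2 * s) by apply: mulr_ge0; lra.
  by rewrite ler_pdivrMr //; have := mulr_ge0 st s0; lra.
by apply/andP; split; lra.
Qed.

(** The part of order at least 2 of the expansion of - ln (1 - 1/p) in powers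
    of 1/p; its sum over p separates the Euler product from the prime sum. *)
Definition log_excess p : R := - ln (1 - p%:R^-1) - p%:R^-1.

(** Damping each prime changes the higher-order terms of its Euler factor by
    O(d ln p / p^2). *)
Lemma prime_sum_zterm_bounds y : (0 < y)%N ->
  ln ((1 - damp y.+1) / d) - prime_sum log_excess y <= prime_sum zterm y <=
  ln (1 + d^-1) - prime_sum log_excess y + 4 * d.
Proof.
move=> y0; have /andP[lo hi] := sum_ln_zterm y0.
have -> : prime_sum zterm y = prime_sum (fun p => - ln (1 - zterm p)) y
    - prime_sum log_excess y
    + prime_sum (fun p => log_excess p - (- ln (1 - zterm p) - zterm p)) y.
  rewrite /prime_sum -!sumrB -big_split /=; apply: eq_bigr => p _; ring.
have H p : prime p -> 0 <= log_excess p - (- ln (1 - zterm p) - zterm p)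
    <= (2 * d) * (ln p%:R / (p%:R * (p%:R - 1))).
  move=> pp; have p2 := prime_ge2R R pp; have /andP[i0 i2] := inv_prime_le pp.
  have z0 := zterm_gt0 (prime_gt0 pp); have zl := zterm_le (prime_gt0 pp).
  have /andP[-> h] := @ln1_sub_bounds p%:R^-1 (zterm p) (introT andP (conj z0 zl)) i2.
  apply: le_trans h _; rewrite -mulrA ler_pM2l // /zterm.
  have L0 := ln_prime_gt0 R pp.
  apply: (@le_trans _ _ (p%:R^-1 * (p%:R^-1 * (d * ln p%:R)))).
    rewrite ler_pM2l // -[X in X - _]mulr1 -mulrBr ler_pM2l //.
    by have := damp_ge p; lra.
  rewrite (_ : _^-1 * _ = d * (ln p%:R * (p%:R^-1 * p%:R^-1))); last by ring.
  by rewrite !ler_pM2l // -invfM lef_pV2 ?posrE; nra.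
have S0 : 0 <= prime_sum (fun p => log_excess p - (- ln (1 - zterm p) - zterm p)) y.
  by apply: prime_sum_ge0 => p /H /andP[].
have S1 : prime_sum (fun p => log_excess p - (- ln (1 - zterm p) - zterm p)) y <= 4 * d.
  apply: (@le_trans _ _ (prime_sum (fun p => (2 * d) * (ln p%:R / (p%:R * (p%:R - 1)))) y)).
    by apply: le_prime_sum => p /H /andP[].
  rewrite /prime_sum -big_distrr /=; have := prime_sum_ln_le R y; rewrite /prime_sum.
  by move=> h; rewrite (_ : 4 * d = 2 * d * 2); [rewrite ler_pM2l // mulr_gt0 | ring].
by apply/andP; split; lra.
Qed.

End PrimeZeta.

(** * The constants *)

Section Constants.
Variable R : realType.
Implicit Types (a b K x : R) (f : nat -> R).

(** Passing to the limit in an inequality; used to let the truncation of the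
    series tend to infinity, and then d to 0. *)
Lemma le_of_le_add_inv a b K N0 :
  (forall N, (N0 <= N)%N -> a <= b + K / N%:R) -> a <= b.
Proof.
move=> H; rewrite leNgt; apply/negP => ba.
pose N := (N0 + (Num.truncn (`|K| / (a - b))).+1)%N.
have ab : 0 < a - b by lra.
have N0R : 0 < N%:R :> R by rewrite ltr0n; lia.
have := H N (leq_addr _ _); suff : K / N%:R < a - b by lra.
rewrite ltr_pdivrMr // mulrC -ltr_pdivrMr //.
apply: le_lt_trans (_ : `|K| / (a - b) < _).
  by rewrite ler_pM2r ?invr_gt0 // ler_norm.
apply: lt_le_trans (_ : (Num.truncn (`|K| / (a - b))).+1%:R <= _).
  have q0 : 0 <= `|K| / (a - b) by rewrite divr_ge0 // ltW.
  by have /andP[] := truncn_itv q0.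
by rewrite ler_nat; lia.
Qed.

(** N x^N is at most the geometric sum of x^i for i < N. *)
Lemma expr_le_inv x N : 0 <= x < 1 -> (0 < N)%N -> x ^+ N <= (1 - x)^-1 / N%:R.
Proof.
move=> /andP[x0 x1] N0; rewrite ler_pdivlMr ?ltr0n // mulr_natr.
have -> : x ^+ N *+ N = \sum_(0 <= i < N) x ^+ N.
  by rewrite sumr_const_nat subn0.
apply: (@le_trans _ _ (\sum_(0 <= i < N) x ^+ i)).
  rewrite big_nat [leRHS]big_nat; apply: ler_sum => i /andP[_ iN].
  by rewrite ler_wiXn2l ?(ltW x1) ?(ltnW iN).
rewrite geometric_sum // ?lt_eqF // expr0 -[leRHS]mul1r ler_wpM2r ?invr_ge0 //; first lra.
by have := exprn_ge0 N x0; lra.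
Qed.

Lemma sum_primes_rate f K :
    (forall p, prime p -> `|f p| <= K / (p%:R * (p%:R - 1))) ->
  forall n, (0 < n)%N -> `|prime_sum f n - sum_primes f| <= K / n%:R.
Proof.
move=> fK.
have K0 : 0 <= K.
  have := le_trans (normr_ge0 _) (fK 2 erefl).
  by rewrite pmulr_lge0 // invr_gt0; lra.
have [n n0|n n0|l lf rate] := @telescope_cvg _ (prime_sum f) (fun n => K / n%:R) 1.
- have nR : 0 < n%:R :> R by rewrite ltr0n.
  have -> : K / n%:R - K / n.+1%:R = K / (n.+1%:R * (n.+1%:R - 1)).
    rewrite -natr1 addrK; field; lra.
  rewrite prime_sumS addrAC subrr add0r; case: ifP => [/fK //|_].
  by rewrite normr0 divr_ge0 // mulr_ge0 // -natr1 addrK.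
- exact: divr_ge0.
suff -> : sum_primes f = l by [].
by apply/cvg_lim => //; rewrite -cvg_shiftS.
Qed.

Lemma euler_gamma_rate n : (0 < n)%N ->
  `|\sum_(1 <= i < n.+1) i%:R^-1 - ln n%:R - euler_gamma R| <= n%:R^-1.
Proof.
pose u n : R := \sum_(1 <= i < n.+1) i%:R^-1 - ln n%:R.
have [{}n n0|{}n n0|l lf rate] := @telescope_cvg _ u (fun n => n%:R^-1) 1.
- have nR : 0 < n%:R :> R by rewrite ltr0n.
  have nR' : 0 < n.+1%:R :> R by rewrite ltr0n.
  rewrite /u big_nat_recr //=.
  have := ln_sub_le nR nR'; have := ln_sub_ge nR nR'.
  rewrite -(natr1 n) addrAC subrr add0r !mul1r.
  by rewrite ler_norml; lra.
- by rewrite invr_ge0.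
suff -> : euler_gamma R = l by exact: rate.
exact/cvg_lim.
Qed.

Lemma log_excess_le p : prime p ->
  `|log_excess R p| <= 1 / (p%:R * (p%:R - 1)).
Proof.
move=> pp; have p2 := prime_ge2R R pp; have /andP[i0 i2] := inv_prime_le R pp.
have q0 : 0 < 1 - p%:R^-1 :> R by lra.
have := ln_sub_le q0 (@ltr01 R); have := ln_sub_ge q0 (@ltr01 R).
rewrite ln1 /log_excess (_ : 1 - (1 - p%:R^-1) = p%:R^-1 :> R); last by ring.
rewrite (_ : p%:R^-1 / (1 - p%:R^-1) = p%:R^-1 + 1 / (p%:R * (p%:R - 1)) :> R).
  by rewrite ler_norml; lra.
by field; do ?[apply/andP; split]; lra.
Qed.

Lemma prime_sum_cat f (a b : nat) : (a <= b)%N ->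
  prime_sum f b = prime_sum f a + \sum_(a.+1 <= p < b.+1 | prime p) f p.
Proof. by move=> ab; rewrite /prime_sum (@big_cat_nat _ _ _ a.+1). Qed.

(** Primes are grouped in dyadic blocks, on each of which the damping factor
    is constant up to a factor z. *)
Lemma dyadic_bounds (d : R) N (z := damp d 2)
    (B := \sum_(1 <= m < N.+1)
       (sum_prime_inv R (2 ^ m) - sum_prime_inv R (2 ^ m.-1)) * z ^+ m) :
  0 < d -> B <= prime_sum (zterm d) (2 ^ N) /\ z * prime_sum (zterm d) (2 ^ N) <= B.
Proof.
move=> d0; rewrite {}/B; elim: N => [|N [IH1 IH2]].
  by rewrite prime_sum1 big_geq // mulr0.
have NN : (2 ^ N <= 2 ^ N.+1)%N by rewrite leq_exp2l.
have z0 : 0 < z := damp_gt0 d 2.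
rewrite big_nat_recr //= /sum_prime_inv !(prime_sum_cat _ NN).
rewrite addrAC subrr add0r big_distrl /=.
rewrite mulrDr; split; apply: lerD; [exact: IH1| |exact: IH2|rewrite big_distrr /=].
  rewrite big_nat_cond [leRHS]big_nat_cond; apply: ler_sum => p /andP[/andP[p1 p2] pp].
  rewrite /zterm ler_wpM2l // /z -dampX //; apply: le_damp => //; lia.
rewrite big_nat_cond [leRHS]big_nat_cond; apply: ler_sum => p /andP[/andP[p1 p2] pp].
rewrite /zterm mulrCA ler_wpM2l // exprS ler_pM2l // /z -dampX //.
by apply: le_damp => //; rewrite expn_gt0 /=; lia.
Qed.

(** Summation by parts for Abel's theorem. *)
Lemma abel_sum (s : nat -> R) (z : R) N :
  \sum_(1 <= m < N.+1) (s m - s m.-1) * z ^+ m =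
  s N * z ^+ N.+1 - s 0 * z + (1 - z) * \sum_(1 <= m < N.+1) s m * z ^+ m.
Proof.
elim: N => [|N IH]; first by rewrite !big_geq // expr1 subrr mulr0 addr0.
by rewrite !(big_nat_recr N.+1) //= IH !exprS; ring.
Qed.

End Constants.

Section MertensConstant.
Variables (R : realType) (M : R).
Hypothesis HM : forall n, (2 <= n)%N ->
  `|sum_prime_inv R n - ln (ln n%:R) - M| <= 7 / ln n%:R.

Let l2 := ln 2 : R.
Let E := sum_primes (log_excess R).
(* the limit of sum_prime_inv (2 ^ m) minus the m-th harmonic number *)
Let L := ln l2 + M - euler_gamma R.
Let C := 7 / l2 + 1.
Let dev m := sum_prime_inv R (2 ^ m) - \sum_(1 <= i < m.+1) i%:R^-1 - L.

Let l2_ge : 2^-1 <= l2.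
Proof. by have := @ln_sub_ge R 1 2 ltr01 (ltr0n _ 2); rewrite ln1 /l2; lra. Qed.

Let C0 : 0 <= C.
Proof. by rewrite addr_ge0 // divr_ge0 //; have := l2_ge; lra. Qed.

Lemma dev0 : dev 0 = - L.
Proof. by rewrite /dev expn0 /sum_prime_inv prime_sum1 big_geq // subrr sub0r. Qed.

Lemma dev_le m : (0 < m)%N -> `|dev m| <= C / m%:R.
Proof.
move=> m0; have mR : 0 < m%:R :> R by rewrite ltr0n.
have l20 : 0 < l2 by have := l2_ge; lra.
have lnm : ln (2 ^ m)%:R = m%:R * l2 :> R by rewrite natrX lnXn // mulr_natl.
have m2 : (2 <= 2 ^ m)%N by rewrite -{1}(expn1 2) leq_exp2l.
have := HM m2; have := euler_gamma_rate R m0.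
rewrite lnm lnM ?posrE // invfM /dev /L /C mulrDl mul1r.
move: (m%:R^-1) (l2^-1) => A B; rewrite !ler_norml; lra.
Qed.

(** Abel's theorem: dev m tends to 0, so the generating function of the dyadic
    prime sums is that of 1/m, namely -ln (1 - z), up to L z and an error
    negligible as z tends to 1. *)
Lemma dyadic_series (z : R) N (Lam := - ln (1 - z))
    (B := \sum_(1 <= m < N.+1)
       (sum_prime_inv R (2 ^ m) - sum_prime_inv R (2 ^ m.-1)) * z ^+ m) :
    0 < z < 1 -> (0 < N)%N ->
  Lam - z ^+ N / (1 - z) + L * z - C / N%:R - C * (1 - z) * Lam <= B
    <= Lam + L * z + C / N%:R + C * (1 - z) * Lam.
Proof.
move=> z01 N0; have /andP[z0 z1] := z01; have NR : 0 < N%:R :> R by rewrite ltr0n.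
have zi : 0 < 1 - z by lra.
pose ell := \sum_(1 <= m < N.+1) z ^+ m / m%:R.
have ellE : ell = \sum_(0 <= m < N) z ^+ m.+1 / m.+1%:R by rewrite /ell big_add1.
have /andP[e1 e2] := log_series N z01; rewrite -ellE -/Lam in e1 e2.
have -> : B = ell + \sum_(1 <= m < N.+1) (dev m - dev m.-1) * z ^+ m.
  rewrite /B /ell -big_split /= big_nat [RHS]big_nat.
  apply: eq_bigr => -[//|m] _ /=.
  by rewrite /dev (big_nat_recr m.+1) //=; ring.
rewrite abel_sum dev0.
have h1 : `|dev N * z ^+ N.+1| <= C / N%:R.
  rewrite normrM -[leRHS]mulr1 ler_pM // ?dev_le //.
  by rewrite ger0_norm ?exprn_ge0 ?exprn_ile1 // ltW.
have h2 : `|(1 - z) * \sum_(1 <= m < N.+1) dev m * z ^+ m| <= C * (1 - z) * Lam.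
  rewrite normrM gtr0_norm // [C * _]mulrC -mulrA ler_pM2l //.
  apply: le_trans (ler_norm_sum _ _ _) _.
  apply: (@le_trans _ _ (C * ell)); last by rewrite ler_wpM2l //; lra.
  rewrite /ell big_distrr /= big_nat [leRHS]big_nat; apply: ler_sum => m /andP[m1 _].
  rewrite normrM (ger0_norm (exprn_ge0 _ (ltW z0))) mulrCA mulrC.
  rewrite ler_wpM2l ?exprn_ge0 ?dev_le //.
  exact: ltW.
move: h1 h2; rewrite !ler_norml; lra.
Qed.

(** The choice z = 1 - 1/j makes - ln (1 - z) equal to ln j; then d is about
    1 / (j ln 2), and both expansions of the prime sum are explicit in j. *)
Lemma mertens_constant_approx j : (2 <= j)%N ->
  `|L - (ln l2 - E)| <=
  (`|L| + `|ln l2 - E - L| + 20 + (C + 1) * ln j%:R) / j%:R.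
Proof.
move=> j2; have jR : 2 <= j%:R :> R by rewrite ler_nat.
pose z : R := 1 - j%:R^-1.
have j0 : 0 < j%:R^-1 :> R by rewrite invr_gt0; lra.
have ji : j%:R^-1 <= 2^-1 :> R by rewrite lef_pV2 ?posrE; lra.
have z01 : 0 < z < 1 by apply/andP; split; rewrite /z; lra.
have /andP[z0 z1] := z01.
have zi : 1 - z = j%:R^-1 by rewrite /z; ring.
have LamE : - ln (1 - z) = ln j%:R by rewrite zi lnV ?opprK // posrE; lra.
have Lam0 : 0 <= ln j%:R :> R by rewrite ln_ge0; lra.
have l20 := l2_ge.
have eta1 : j%:R^-1 <= - ln z.
  by have := ln_sub_le (@ltr01 R) z0; rewrite ln1 divr1 /z; lra.
have eta2 : - ln z <= 2 / j%:R.
  have := ln_sub_le z0 (@ltr01 R); rewrite ln1 zi.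
  suff : j%:R^-1 / z <= 2 / j%:R by lra.
  by rewrite ler_pdivrMr // mulrAC ler_pMl // /z; lra.
pose d := - ln z / l2.
have d0 : 0 < d by rewrite divr_gt0; lra.
have dz : damp d 2 = z.
  by rewrite /damp mulNr -/l2 /d divfK ?opprK ?lnK ?posrE //; lra.
have d4 : d <= 4 / j%:R.
  by rewrite /d ler_pdivrMr; [nra | lra].
have lnd : ln d = ln (- ln z) - ln l2 by rewrite ln_div ?posrE //; lra.
clearbody d.
have lneta1 : - ln (- ln z) <= ln j%:R.
  have : ln (j%:R^-1) <= ln (- ln z) by rewrite ler_ln ?posrE //; lra.
  by rewrite lnV ?posrE; lra.
have lneta2 : ln j%:R - 2 / j%:R <= - ln (- ln z).
  have : ln (- ln z) <= ln (j%:R^-1 / z).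
    rewrite ler_ln ?posrE ?divr_gt0 //; last by lra.
    by have := ln_sub_le z0 (@ltr01 R); rewrite ln1 zi; lra.
  rewrite ln_div ?posrE // lnV ?posrE; last by lra.
  lra.
have ERate N : (0 < N)%N -> `|prime_sum (log_excess R) (2 ^ N) - E| <= N%:R^-1.
  move=> N0; have h : (0 < 2 ^ N)%N by rewrite expn_gt0.
  apply: le_trans (sum_primes_rate (@log_excess_le R) h) _.
  by rewrite mul1r lef_pV2 ?posrE ?ltr0n // ler_nat ltnW // ltn_expl.
have zN N : (0 < N)%N -> z ^+ N <= j%:R / N%:R.
  by move=> N0; have := @expr_le_inv R z N; rewrite zi invrK; apply=> //; rewrite ltW.
have upper : ln j%:R + L * z - C * (1 - z) * ln j%:R <= ln (1 + d^-1) - E + 4 * d.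
  apply: (@le_of_le_add_inv _ _ _ (j%:R * j%:R + C + 1) 1) => N N1.
  have NR : 0 < N%:R^-1 :> R by rewrite invr_gt0 ltr0n.
  have [B1 _] := @dyadic_bounds R d N d0.
  have /andP[B2 _] := dyadic_series z01 N1; rewrite dz in B1.
  have N2 : (0 < 2 ^ N)%N by rewrite expn_gt0.
  have /andP[_ B3] := prime_sum_zterm_bounds d0 N2.
  have := ERate N N1; rewrite ler_norml => /andP[E1 E2].
  have Z : z ^+ N / (1 - z) <= j%:R * j%:R / N%:R.
    by rewrite zi invrK mulrC -mulrA ler_wpM2l // zN.
  by move: (le_trans B2 (le_trans B1 B3)); rewrite LamE; lra.
have lower : z * (- ln d - E) <= ln j%:R + L * z + C * (1 - z) * ln j%:R.
  apply: (@le_of_le_add_inv _ _ _ (2 * j%:R + 1 + C) (2 * j)) => N N2j.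
  have N1 : (0 < N)%N by rewrite (leq_trans _ N2j) // muln_gt0 (ltnW j2).
  have NR : 0 < N%:R :> R by rewrite ltr0n.
  have [_ B1] := @dyadic_bounds R d N d0.
  have /andP[_ B2] := dyadic_series z01 N1; rewrite dz in B1.
  have N2 : (0 < 2 ^ N)%N by rewrite expn_gt0.
  have /andP[B3 _] := prime_sum_zterm_bounds d0 N2.
  have := ERate N N1; rewrite ler_norml => /andP[E1 E2].
  pose w := damp d (2 ^ N).+1.
  have w0 : 0 < w := damp_gt0 _ _.
  have wN : w <= j%:R / N%:R.
    by apply: le_trans (zN N N1); rewrite -dz -dampX //; apply: le_damp; rewrite ?N2 /=.
  rewrite -/w in B3; clearbody w.
  have w2 : w <= 2^-1.
    apply: le_trans wN _; rewrite ler_pdivrMr // ler_pdivlMl // -natrM ler_nat.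
    exact: N2j.
  have lw : - (2 * (j%:R / N%:R)) <= ln (1 - w).
    have w1 : 0 < 1 - w by lra.
    have := ln_sub_ge (@ltr01 R) w1; rewrite ln1 subr0; apply: le_trans.
    rewrite ler_pdivlMr //.
    move: (j%:R / N%:R) wN w2 w0 w1 => q wq w2 w0 w1.
    have : 0 <= q * (1 - 2 * w) by apply: mulr_ge0; lra.
    lra.
  have : z * (- ln d - E - 2 * (j%:R / N%:R) - N%:R^-1) <=
      ln j%:R + L * z + C / N%:R + C * (1 - z) * ln j%:R.
    rewrite -LamE; apply: le_trans B2; apply: le_trans B1; rewrite ler_pM2l //.
    apply: le_trans B3; rewrite ln_div ?posrE //; lra.
  have NI : 0 <= N%:R^-1 :> R by rewrite invr_ge0 ltW.
  have : z * (2 * (j%:R / N%:R) + N%:R^-1) <= 2 * (j%:R / N%:R) + N%:R^-1.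
    by rewrite ler_piMl ?addr_ge0 ?mulr_ge0 ?(ltW z1).
  lra.
have lnd1 : ln (1 + d^-1) <= d - ln d.
  have -> : 1 + d^-1 = (1 + d) / d by field; lra.
  rewrite ln_div ?posrE //; last by lra.
  by have := @le_ln1Dx R d; lra.
rewrite lnd in lower lnd1; rewrite zi in lower upper.
have up : L - (ln l2 - E) <= (L + 20 + C * ln j%:R) / j%:R.
  by move: upper lneta1 lnd1 d4; rewrite /z; nra.
have lo : (ln l2 - E) - L <= (ln l2 - E - L + 2 + (C + 1) * ln j%:R) / j%:R.
  have : z * (ln l2 + (ln j%:R - 2 / j%:R) - E) <= z * (- (ln (- ln z) - ln l2) - E).
    by rewrite ler_pM2l //; lra.
  have h2 : z * (2 / j%:R) <= 2 / j%:R by rewrite ler_piMl ?divr_ge0 //; lra.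
  by move: h2 lower; rewrite /z; lra.
rewrite ler_norml; apply/andP; split.
  rewrite lerNl opprB; apply: le_trans lo _; rewrite ler_pM2r // lerD2r.
  by have := ler_norm (ln l2 - E - L); have := normr_ge0 L; lra.
apply: le_trans up _; rewrite ler_pM2r //.
have := ler_norm L; have := normr_ge0 (ln l2 - E - L); lra.
Qed.

(** The bound of [mertens_constant_approx] is O(ln j / j), hence O(1/i) along
    the squares j = i^2, by ln i <= i. *)
Theorem mertens_constant : M = euler_gamma R - E.
Proof.
suff : `|L - (ln l2 - E)| <= 0 by rewrite normr_le0 subr_eq0 /L => /eqP; lra.
pose A := `|L| + `|ln l2 - E - L| + 20.
apply: (@le_of_le_add_inv _ _ _ (A + 2 * (C + 1)) 2) => i i2; rewrite add0r.
have i0 : 0 < i%:R :> R by rewrite ltr0n; lia.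
have i1 : 1 <= i%:R :> R by rewrite ler1n; lia.
have ii2 : (2 <= i ^ 2)%N by rewrite (leq_trans i2) // -{1}(expn1 i) leq_exp2l.
apply: le_trans (mertens_constant_approx ii2) _; rewrite -/A.
rewrite natrX lnXn // expr2 invfM mulrA ler_pM2r ?invr_gt0 // ler_pdivrMr //.
have A0 : 0 <= A by rewrite !addr_ge0.
have h1 : A <= A * i%:R by rewrite ler_peMr.
have h2 : (C + 1) * ln i%:R <= (C + 1) * i%:R.
  apply: ler_wpM2l; last exact: ltW (ln_sublinear i0).
  by have := C0; lra.
rewrite mulr2n; lra.
Qed.

End MertensConstant.

(** * The contribution of one prime *)

Section OnePrime.
Variable R : realType.
Implicit Types (a b u : R).

Lemma lipschitz_expr k a b : 0 <= a <= 1 -> 0 <= b <= 1 ->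
  `|a ^+ k - b ^+ k| <= k%:R * `|a - b|.
Proof.
move=> /andP[a0 a1] /andP[b0 b1]; rewrite subrXX normrM mulrC ler_wpM2r //.
apply: le_trans (ler_norm_sum _ _ _) _.
apply: (@le_trans _ _ (\sum_(i < k) 1)); last by rewrite sumr_const card_ord.
apply: ler_sum => i _; rewrite ger0_norm ?mulr_ge0 ?exprn_ge0 //.
by rewrite mulr_ile1 ?exprn_ge0 ?exprn_ile1.
Qed.

Definition binom_sign k j : R := (-1) ^+ (j - 1)%N * 'C(k, j)%:R.
Definition geom_term j p : R := (p%:R ^+ (j - 1)%N * (p%:R ^+ j - 1))^-1.
(** By [prime_weight_trunc] this is the sum over all v >= 2 of
    p (1 - (1 - p^(-v))^k), that is, of p times the limiting proportion of the
    tuples with an entry divisible by p^v. *)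
Definition prime_weight k p : R :=
  \sum_(1 <= j < k.+1) binom_sign k j * geom_term j p.

Lemma binom_sub1 k u :
  1 - (1 - u) ^+ k = \sum_(1 <= j < k.+1) binom_sign k j * u ^+ j.
Proof.
rewrite exprBn -(big_mkord xpredT
  (fun j => ((-1) ^+ j * 1 ^+ (k - j) * u ^+ j) *+ 'C(k, j))).
rewrite big_ltn // bin0 !expr0 expr1n !mulr1 mulr1n opprD addrA subrr add0r.
rewrite -sumrN big_nat [RHS]big_nat; apply: eq_bigr => -[//|j] _.
by rewrite /binom_sign subn1 /= expr1n mulr1 exprS mulN1r -mulr_natr; ring.
Qed.

Lemma norm_binom_sign k j : `|binom_sign k j| = 'C(k, j)%:R.
Proof. by rewrite normrM normrX normrN1 expr1n mul1r ger0_norm. Qed.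

Lemma sum_norm_binom_sign k : \sum_(1 <= j < k.+1) `|binom_sign k j| <= 2 ^+ k.
Proof.
under eq_bigr do rewrite norm_binom_sign.
have -> : 2 ^+ k = \sum_(0 <= j < k.+1) 'C(k, j)%:R :> R.
  rewrite big_mkord -[2]/(1 + 1) exprDn; apply: eq_bigr => i _.
  by rewrite !expr1n mulr1.
by rewrite [leRHS]big_ltn // lerDr.
Qed.

(** Expand the power by the binomial theorem and sum over v first: every
    resulting geometric series has ratio p^(-j) <= 1/2, and the tail beyond W
    is at most twice its own first term. *)
Lemma prime_weight_trunc k p W : prime p -> (0 < W)%N ->
  `|p%:R * (\sum_(2 <= v < W.+1) (1 - (1 - p%:R^-1 ^+ v) ^+ k)) - prime_weight k p|
  <= 2 ^+ k.+1 * p%:R / p%:R ^+ W.+1.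
Proof.
move=> pp W0; have p2 := prime_ge2R R pp; have /andP[i0 i2] := inv_prime_le R pp.
set q : R := p%:R^-1 in i0 i2 *.
have pq : p%:R = q^-1 :> R by rewrite invrK.
have qj j : (0 < j)%N -> 0 <= q ^+ j <= q.
  move=> j0; have q0 := ltW i0; apply/andP; split; first exact: exprn_ge0.
  by rewrite -{2}[q]expr1; apply: ler_wiXn2l => //; lra.
have -> : p%:R * (\sum_(2 <= v < W.+1) (1 - (1 - q ^+ v) ^+ k)) - prime_weight k p
    = - \sum_(1 <= j < k.+1) binom_sign k j * (p%:R * ((q ^+ j) ^+ W.+1 / (1 - q ^+ j))).
  under eq_bigr do rewrite binom_sub1.
  rewrite exchange_big /= big_distrr /= -sumrB -sumrN.
  rewrite big_nat [RHS]big_nat; apply: eq_bigr => j /andP[j1 _].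
  rewrite -big_distrr /=; under eq_bigr do rewrite -exprM mulnC exprM.
  have /andP[Q0 Q1] := qj j j1.
  rewrite geometric_sum //; last by apply/negP => /eqP Q; rewrite Q in Q1; lra.
  rewrite mulrCA -mulrBr -mulrN; congr (_ * _).
  rewrite mulrBl mulrBr addrAC -[RHS]add0r; congr (_ - _).
  have -> : geom_term j p = q ^+ (j - 1) * q ^+ j / (1 - q ^+ j).
    rewrite /geom_term pq !exprVn.
    have pj : 2 <= p%:R ^+ j :> R.
      apply: (le_trans p2); rewrite -{1}[p%:R]expr1.
      by apply: ler_weXn2l => //; lra.
    have p0 : p%:R != 0 :> R by rewrite lt0r_neq0 //; lra.
    by field; rewrite !expf_neq0 //= andbT; lra.
  apply/eqP; rewrite subr_eq0 mulrA; apply/eqP; congr (_ / _).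
  case: j j1 {Q0 Q1} => // j _; rewrite subn1 /= expr2 mulrA; congr (_ * _).
  by rewrite exprS mulrA pq mulVf ?mul1r // lt0r_neq0.
rewrite normrN; apply: le_trans (ler_norm_sum _ _ _) _.
apply: (@le_trans _ _ (\sum_(1 <= j < k.+1) `|binom_sign k j| *
    (2 * p%:R * q ^+ W.+1))).
  rewrite big_nat [leRHS]big_nat; apply: ler_sum => j /andP[j1 _].
  have /andP[Q0 Q1] := qj j j1.
  rewrite normrM ler_wpM2l // ger0_norm; last first.
    by rewrite mulr_ge0 // divr_ge0 ?exprn_ge0 //; lra.
  rewrite [leRHS](_ : _ = p%:R * (q ^+ W.+1 * 2)); last by ring.
  apply: ler_wpM2l => //; apply: ler_pM; rewrite ?exprn_ge0 ?invr_ge0 //; first lra.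
    by rewrite lerXn2r ?nnegrE // ltW.
  by rewrite invf_ple ?posrE; lra.
rewrite -big_distrl /=.
have -> : 2 ^+ k.+1 * p%:R / p%:R ^+ W.+1 = 2 ^+ k * (2 * p%:R * q ^+ W.+1).
  by rewrite (exprS 2 k) exprVn; ring.
apply: ler_wpM2r; last exact: sum_norm_binom_sign.
by rewrite !mulr_ge0 // exprn_ge0 // ltW.
Qed.

End OnePrime.

Section FiniteLevel.
Variable R : realType.

Definition lcm_count k N p : R :=
  \sum_(2 <= v < N.+1) (N ^ k - (N - N %/ p ^ v) ^ k)%N%:R.

(** Exponents beyond log_p N contribute nothing, as floor (N / p^v) = 0. *)
Lemma lcm_countE k N p (V := trunc_log p N) : prime p -> (p ^ 2 <= N)%N ->
    (0 < k)%N ->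
  lcm_count k N p =
  N%:R ^+ k * \sum_(2 <= v < V.+1) (1 - (1 - (N %/ p ^ v)%:R / N%:R) ^+ k).
Proof.
move=> pp pN k0; have p1 := prime_gt1 pp.
have N0 : (0 < N)%N by apply: leq_trans pN; rewrite expn_gt0 prime_gt0.
have V2 : (2 <= V)%N by apply: trunc_log_max.
have VN : (V <= N)%N.
  by apply: leq_trans (trunc_logP p1 N0); rewrite ltnW // ltn_expl.
rewrite /lcm_count (big_cat_nat (leqW V2) (VN : V.+1 <= N.+1)%N) /=.
rewrite [X in _ + X]big_nat [X in _ + X]big1 ?addr0; last first.
  move=> v /andP[Vv _]; rewrite divn_small ?subn0 ?subnn //.
  by apply: leq_trans (trunc_log_ltn N p1) _; rewrite leq_exp2l.
rewrite big_distrr /=; apply: eq_bigr => v _.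
have NR : N%:R != 0 :> R by rewrite pnatr_eq0 -lt0n.
have -> : 1 - (N %/ p ^ v)%:R / N%:R = (N - N %/ p ^ v)%N%:R / N%:R :> R.
  by rewrite natrB ?leq_div // mulrBl divff.
have le : ((N - N %/ p ^ v) ^ k <= N ^ k)%N by rewrite leq_exp2r // leq_subr.
rewrite (natrB R le) !natrX mulrBr mulr1 expr_div_n mulrCA mulfV ?mulr1 //.
exact: expf_neq0.
Qed.

(** Each of the log_p N relevant floors changes a term by O(p / N), since
    u |-> (1 - u)^k is k-Lipschitz on [0, 1]; the truncated tail is O(p / N)
    because p^(V+1) > N for V = floor (log_p N). *)
Lemma lcm_count_weight k N p : prime p -> (p ^ 2 <= N)%N -> (0 < k)%N ->
  `|p%:R * lcm_count k N p / N%:R ^+ k - prime_weight R k p| <=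
  (k%:R + 2 ^+ k.+1) * ((trunc_log p N)%:R * p%:R) / N%:R.
Proof.
move=> pp pN k0; have p1 := prime_gt1 pp; have p2 := prime_ge2R R pp.
have N0 : (0 < N)%N by apply: leq_trans pN; rewrite expn_gt0 prime_gt0.
have NR : 0 < N%:R :> R by rewrite ltr0n.
set V := trunc_log p N.
have V2 : (2 <= V)%N by apply: trunc_log_max.
pose T := \sum_(2 <= v < V.+1) (1 - (1 - p%:R^-1 ^+ v) ^+ k) : R.
pose S := \sum_(2 <= v < V.+1) (1 - (1 - (N %/ p ^ v)%:R / N%:R) ^+ k) : R.
have -> : p%:R * lcm_count k N p / N%:R ^+ k = p%:R * S.
  rewrite lcm_countE // -/V -/S mulrCA mulrAC mulfV ?mul1r //.
  by rewrite expf_neq0 // lt0r_neq0.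
have ST : `|S - T| <= V%:R * (k%:R / N%:R).
  rewrite /S /T -sumrB; apply: le_trans (ler_norm_sum _ _ _) _.
  apply: (@le_trans _ _ (\sum_(2 <= v < V.+1) k%:R / N%:R)); last first.
    rewrite sumr_const_nat -[X in X <= _]mulr_natl ler_wpM2r ?divr_ge0 //.
    by rewrite ler_nat; lia.
  apply: ler_sum => v _; set m := (N %/ p ^ v)%N.
  have q0 : 0 < p%:R^-1 ^+ v :> R by rewrite exprn_gt0 // invr_gt0; lra.
  have q1 : p%:R^-1 ^+ v <= 1 :> R.
    by rewrite exprn_ile1 ?invr_ge0 // invf_le1; lra.
  have mN0 : 0 <= m%:R / N%:R :> R by rewrite divr_ge0.
  have mN1 : m%:R / N%:R <= 1 :> R by rewrite ler_pdivrMr // mul1r ler_nat leq_div.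
  have qv : N%:R * p%:R^-1 ^+ v = N%:R / (p ^ v)%:R :> R by rewrite natrX exprVn.
  have le1 : m%:R <= N%:R * p%:R^-1 ^+ v :> R by rewrite qv natr_divn_le.
  have ge1 : N%:R * p%:R^-1 ^+ v - 1 <= m%:R :> R.
    by rewrite qv ltW // natr_divn_gt // expn_gt0 prime_gt0.
  have -> : 1 - (1 - m%:R / N%:R) ^+ k - (1 - (1 - p%:R^-1 ^+ v) ^+ k) =
     (1 - p%:R^-1 ^+ v) ^+ k - (1 - m%:R / N%:R) ^+ k :> R by ring.
  apply: le_trans (lipschitz_expr _ _ _) _; try by apply/andP; split; lra.
  rewrite ler_wpM2l //.
  have -> : 1 - p%:R^-1 ^+ v - (1 - m%:R / N%:R) =
      (m%:R - N%:R * p%:R^-1 ^+ v) / N%:R :> R by field; lra.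
  rewrite normrM normfV (gtr0_norm NR) ler_piMl ?invr_ge0 ?(ltW NR) //.
  by rewrite ler_norml; lra.
have TW : `|p%:R * T - prime_weight R k p| <= 2 ^+ k.+1 * p%:R / N%:R.
  have V0 : (0 < V)%N by lia.
  apply: le_trans (prime_weight_trunc R k pp V0) _.
  rewrite ler_wpM2l ?mulr_ge0 // lef_pV2 ?posrE ?exprn_gt0 //; last by lra.
  by rewrite -natrX ler_nat ltnW // trunc_log_ltn.
have -> : p%:R * S - prime_weight R k p =
   p%:R * (S - T) + (p%:R * T - prime_weight R k p) by ring.
apply: le_trans (ler_normD _ _) _; rewrite normrM (ger0_norm (ler0n R p)).
have h1 : p%:R * `|S - T| <= p%:R * (V%:R * (k%:R / N%:R)) by rewrite ler_wpM2l.
have h2 : 2 ^+ k.+1 * p%:R / N%:R <= V%:R * (2 ^+ k.+1 * p%:R / N%:R) :> R.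
  by apply: ler_peMl; [rewrite divr_ge0 // mulr_ge0 | rewrite ler1n; lia].
lra.
Qed.

(** ln x grows slower than any root of x; the fourth root suffices here. *)
Lemma ln_le_root4 (x : R) : 0 < x -> ln x <= 4 * Num.sqrt (Num.sqrt x).
Proof.
have half (z : R) : 0 < z -> ln z = 2 * ln (Num.sqrt z).
  move=> z0; rewrite -{1}(sqr_sqrtr (ltW z0)) lnXn ?sqrtr_gt0 //.
  by rewrite mulr_natl.
move=> x0; have s0 : 0 < Num.sqrt x by rewrite sqrtr_gt0.
have s1 : 0 < Num.sqrt (Num.sqrt x) by rewrite sqrtr_gt0.
by rewrite half // half //; have := ln_sublinear s1; lra.
Qed.

Lemma ln2_ge_half : 2^-1 <= ln 2 :> R.
Proof. by have := @ln_sub_ge R 1 2 ltr01 (ltr0n _ 2); rewrite ln1; lra. Qed.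

Lemma trunc_log_ln p N : prime p -> (0 < N)%N ->
  (trunc_log p N)%:R * ln p%:R <= ln N%:R :> R.
Proof.
move=> pp N0; have p0 : 0 < p%:R :> R by rewrite ltr0n prime_gt0.
rewrite mulr_natl -lnXn // ler_ln ?posrE ?exprn_gt0 // ?ltr0n //.
by rewrite -natrX ler_nat trunc_logP // prime_gt1.
Qed.

(** For p <= N^(1/4) the exponent is at most 2 ln N, and these primes add up
    to O(N^(3/4) ln N). For larger p it is at most 3, and ln p >= ln N / 4
    lets Chebyshev's estimate for theta save a factor ln N. *)
Lemma sum_trunc_log N y : (2 <= N)%N -> (y ^ 2 <= N)%N ->
  prime_sum (fun p => (trunc_log p N)%:R * p%:R : R) y <= 600 * (N%:R / ln N%:R).
Proof.
move=> N2 yN; have NR : 0 < N%:R :> R by rewrite ltr0n; lia.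
have L0 : 0 < ln N%:R :> R by rewrite ln_gt0 // ltr1n.
pose t : R := Num.sqrt (Num.sqrt N%:R).
have t0 : 0 < t by rewrite !sqrtr_gt0.
have t4 : t ^+ 4 = N%:R.
  by rewrite (exprM t 2 2) /t !sqr_sqrtr ?sqrtr_ge0 // ltW.
have yt : y%:R <= t ^+ 2.
  rewrite -(ler_pXn2r (n := 2)) ?nnegrE ?exprn_ge0 ?(ltW t0) //.
  by rewrite -exprM t4 -natrX ler_nat.
have H p : prime p -> (p <= y)%N ->
    (trunc_log p N)%:R * p%:R <= 2 * ln N%:R * t + 12 * y%:R / ln N%:R * ln p%:R :> R.
  move=> pp py; have p2 := prime_ge2R R pp.
  have lp := ln_prime_gt0 R pp; have tl := trunc_log_ln pp (ltnW N2).
  have ln2p : 2^-1 <= ln p%:R :> R.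
    by apply: le_trans ln2_ge_half _; rewrite ler_ln ?posrE //; lra.
  have A0 : 0 <= 2 * ln N%:R * t by rewrite !mulr_ge0 ?ltW.
  have B0 : 0 <= 12 * y%:R / ln N%:R * ln p%:R :> R.
    by rewrite !mulr_ge0 ?invr_ge0 // ltW.
  have [pt|tp] := leP p%:R t.
    apply: (@le_trans _ _ (2 * ln N%:R * t)); last by lra.
    apply: ler_pM => //.
    have := ler_wpM2l (ler0n R (trunc_log p N)) ln2p; lra.
  apply: (@le_trans _ _ (12 * y%:R / ln N%:R * ln p%:R)); last by lra.
  have V3 : (trunc_log p N <= 3)%N.
    rewrite leqNgt; apply/negP => V4.
    have : (p ^ 4 <= N)%N.
      apply: leq_trans (trunc_logP (prime_gt1 pp) (ltnW N2)).
      by rewrite leq_exp2l // prime_gt1.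
    rewrite -(ler_nat R) natrX -t4 leNgt => /negP; apply.
    by rewrite ltrXn2r // ltW.
  have lnp : ln N%:R <= 4 * ln p%:R :> R.
    rewrite -t4 lnXn // -(mulr_natl (ln t)) ler_wpM2l // ler_ln ?posrE ?(ltW tp) //; lra.
  have : 1 <= 4 * ln p%:R / ln N%:R :> R by rewrite ler_pdivlMr // mul1r.
  rewrite (_ : 12 * _ / _ * _ = 3 * y%:R * (4 * ln p%:R / ln N%:R)); last by ring.
  move=> h; apply: (@le_trans _ _ (3 * y%:R)).
    by apply: ler_pM; rewrite ?ler_nat.
  by rewrite ler_peMr // mulr_ge0.
apply: le_trans (le_prime_sum H) _.
have -> : prime_sum (fun p => 2 * ln N%:R * t + 12 * y%:R / ln N%:R * ln p%:R) y =
    prime_sum (fun=> 2 * ln N%:R * t) y + 12 * y%:R / ln N%:R * theta R y.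
  by rewrite /theta /prime_sum big_split /= big_distrr.
have h1 : prime_sum (fun=> 2 * ln N%:R * t) y <= y%:R * (2 * ln N%:R * t).
  rewrite /prime_sum big_ltn_cond //=.
  apply: (@le_trans _ _ (\sum_(1 <= p < y.+1) 2 * ln N%:R * t)).
    rewrite big_mkcond; apply: ler_sum => p _; case: ifP => // _.
    by rewrite !mulr_ge0 ?ltW.
  by rewrite sumr_const_nat subn1 /= -[X in X <= _]mulr_natl.
have h2 : 12 * y%:R / ln N%:R * theta R y <= 36 * (N%:R / ln N%:R).
  apply: (@le_trans _ _ (12 * y%:R / ln N%:R * (3 * y%:R))).
    by rewrite ler_wpM2l ?theta_le // divr_ge0 ?mulr_ge0 // ltW.
  rewrite (_ : _ * (3 * _) = 36 * (y%:R ^+ 2 / ln N%:R)); last by ring.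
  by rewrite ler_pM2l // ler_pM2r ?invr_gt0 // -natrX ler_nat.
have h3 : y%:R * (2 * ln N%:R * t) <= 512 * (N%:R / ln N%:R).
  apply: (@le_trans _ _ (t ^+ 2 * (2 * ln N%:R * t))).
    by rewrite ler_wpM2r // !mulr_ge0 ?ltW.
  have st : 0 < Num.sqrt t by rewrite sqrtr_gt0.
  have lt : ln t = 2 * ln (Num.sqrt t).
    by rewrite -{1}(sqr_sqrtr (ltW t0)) lnXn // mulr_natl.
  have l8 : ln N%:R <= 8 * Num.sqrt t :> R.
    rewrite -t4 lnXn // -(mulr_natl (ln t)) lt.
    by have := ln_sublinear st; lra.
  have l64 : ln N%:R * ln N%:R <= 64 * t.
    rewrite (_ : 64 * t = (8 * Num.sqrt t) * (8 * Num.sqrt t)).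
      by apply: ler_pM; rewrite // ltW.
    by rewrite -{1}(sqr_sqrtr (ltW t0)); ring.
  rewrite [leRHS]mulrA ler_pdivlMr //.
  rewrite [leLHS](_ : _ = 2 * t ^+ 3 * (ln N%:R * ln N%:R)); last by ring.
  rewrite [leRHS](_ : _ = 8 * t ^+ 3 * (64 * t)); last by rewrite -t4; ring.
  apply: ler_pM => //; rewrite ?mulr_ge0 ?exprn_ge0 ?(ltW t0) ?(ltW L0) //.
  rewrite ler_wpM2r ?exprn_ge0 ?(ltW t0) //; lra.
have : 0 <= N%:R / ln N%:R :> R by rewrite divr_ge0 // ltW.
lra.
Qed.

End FiniteLevel.

(** * Assembling the asymptotic formula *)

Section Assembly.
Variable R : realType.

Lemma geom_term_le j p : (1 < j)%N -> prime p ->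
  `|geom_term R j p| <= 1 / (p%:R * (p%:R - 1)).
Proof.
move=> j1 pp; have p2 := prime_ge2R R pp.
have pge m : (0 < m)%N -> p%:R <= p%:R ^+ m :> R.
  by move=> m0; rewrite -{1}[p%:R]expr1; apply: ler_weXn2l => //; lra.
have h1 : p%:R <= p%:R ^+ (j - 1) :> R by apply: pge; lia.
have h2 : p%:R <= p%:R ^+ j :> R by apply: pge; lia.
rewrite /geom_term normfV mul1r ger0_norm; last by rewrite mulr_ge0; lra.
rewrite lef_pV2 ?posrE; first (apply: ler_pM; lra); by rewrite mulr_gt0; lra.
Qed.

Lemma constF_term_le p : prime p ->
  `|ln (1 - p%:R^-1) + (p%:R - 1)^-1 : R| <= 2 / (p%:R * (p%:R - 1)).
Proof.
move=> pp; have p2 := prime_ge2R R pp.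
have -> : ln (1 - p%:R^-1) + (p%:R - 1)^-1 =
    1 / (p%:R * (p%:R - 1)) - log_excess R p :> R.
  by rewrite /log_excess; field; do ?[apply/andP; split]; lra.
have D : 0 <= 1 / (p%:R * (p%:R - 1)) :> R by rewrite divr_ge0 // mulr_ge0; lra.
apply: le_trans (ler_normB _ _) _; rewrite (ger0_norm D).
have := log_excess_le R pp; lra.
Qed.

(** Splitting 1/(p - 1) as 1/p plus two convergent series turns the weight of
    the primes up to y into Mertens' sum. *)
Lemma prime_sum_prime_weight k : (0 < k)%N -> exists K, forall y, (2 <= y)%N ->
  `|prime_sum (prime_weight R k) y - (k%:R * ln (ln y%:R) + constH R k)| <= K / ln y%:R.
Proof.
move=> k0; have [M HM] := mertens_second R; have ME := mertens_constant HM.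
pose f1 p : R := ln (1 - p%:R^-1) + (p%:R - 1)^-1.
exists (k%:R * 7 + k%:R * 2 + k%:R * 1 + 2 ^+ k) => y y2.
have y0 : (0 < y)%N by lia.
have L0 : 0 < ln y%:R :> R by rewrite ln_gt0 // ltr1n.
have yL : y%:R^-1 <= (ln y%:R)^-1 :> R.
  by rewrite lef_pV2 ?posrE ?ltr0n // ltW // ln_sublinear // ltr0n.
have bs1 : binom_sign R k 1 = k%:R by rewrite /binom_sign subnn expr0 mul1r bin1.
have -> : prime_sum (prime_weight R k) y =
    k%:R * (prime_sum f1 y + prime_sum (log_excess R) y + sum_prime_inv R y) +
    \sum_(2 <= j < k.+1) binom_sign R k j * prime_sum (geom_term R j) y.
  rewrite /prime_sum /prime_weight exchange_big /= big_ltn //= bs1; congr (_ + _).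
    rewrite /sum_prime_inv /prime_sum -!big_split -big_distrr /=.
    congr (_ * _); apply: eq_bigr => p _.
    rewrite /geom_term /f1 /log_excess subnn expr0 mul1r expr1; ring.
  by apply: eq_bigr => j _; rewrite big_distrr.
rewrite /constH /constF -/f1.
set Sj := \sum_(2 <= j < k.+1) binom_sign R k j * _.
set Hj := (X in _ - (_ + (_ + X))).
have -> : k%:R * (prime_sum f1 y + prime_sum (log_excess R) y + sum_prime_inv R y) + Sj -
    (k%:R * ln (ln y%:R) + (k%:R * (euler_gamma R + sum_primes f1) + Hj)) =
    k%:R * (sum_prime_inv R y - ln (ln y%:R) - M) + k%:R * (prime_sum f1 y - sum_primes f1)
    + k%:R * (prime_sum (log_excess R) y - sum_primes (log_excess R)) + (Sj - Hj).
  by rewrite ME; ring.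
have b1 : `|k%:R * (sum_prime_inv R y - ln (ln y%:R) - M)| <= k%:R * (7 / ln y%:R).
  by rewrite normrM ger0_norm // ler_wpM2l ?HM.
have b2 : `|k%:R * (prime_sum f1 y - sum_primes f1)| <= k%:R * (2 / ln y%:R).
  rewrite normrM ger0_norm // ler_wpM2l //.
  apply: le_trans (sum_primes_rate constF_term_le y0) _; exact: ler_wpM2l.
have b3 : `|k%:R * (prime_sum (log_excess R) y - sum_primes (log_excess R))|
    <= k%:R * (1 / ln y%:R).
  rewrite normrM ger0_norm // ler_wpM2l //.
  apply: le_trans (sum_primes_rate (@log_excess_le R) y0) _; exact: ler_wpM2l.
have b4 : `|Sj - Hj| <= 2 ^+ k * (ln y%:R)^-1.
  rewrite /Sj /Hj -sumrB; apply: le_trans (ler_norm_sum _ _ _) _.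
  apply: (@le_trans _ _ (\sum_(2 <= j < k.+1) `|binom_sign R k j| * (ln y%:R)^-1)).
    rewrite big_nat [leRHS]big_nat; apply: ler_sum => j /andP[j2 _].
    rewrite -mulrBr normrM ler_wpM2l //.
    have gl p : prime p -> `|geom_term R j p| <= 1 / (p%:R * (p%:R - 1)).
      exact: geom_term_le.
    by apply: le_trans (sum_primes_rate gl y0) _; rewrite mul1r.
  rewrite -big_distrl /= ler_wpM2r ?invr_ge0 ?(ltW L0) //.
  apply: le_trans (sum_norm_binom_sign R k).
  by rewrite [leRHS]big_ltn // lerDr.
rewrite !mulrDl -!mulrA.
apply: le_trans (ler_normD _ _) _; apply: lerD => //.
apply: le_trans (ler_normD _ _) _; apply: lerD => //.
by apply: le_trans (ler_normD _ _) _; apply: lerD.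
Qed.

(** For p > y every p^v with v >= 2 exceeds N, so only the primes up to y
    occur. *)
Lemma sum_B_lcm_weight k (x : R) (N := Num.truncn x) y : (0 < k)%N ->
    (2 <= N)%N -> (y ^ 2 <= N)%N -> (N < y.+1 ^ 2)%N ->
  `|sum_B_lcm k x / N%:R ^+ k - prime_sum (prime_weight R k) y| <=
  (k%:R + 2 ^+ k.+1) * 600 / ln N%:R.
Proof.
move=> k0 N2 yN Ny; have NR : 0 < N%:R :> R by rewrite ltr0n; lia.
have yN' : (y <= N)%N.
  by apply: leq_trans yN; rewrite expnS expn1; case: (y) => // m; rewrite leq_pmulr.
have -> : sum_B_lcm k x = prime_sum (fun p => p%:R * lcm_count R k N p) y.
  rewrite sum_B_lcmE -/N -[LHS]/(prime_sum (fun p => p%:R * lcm_count R k N p) N).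
  rewrite (prime_sum_cat _ yN') [X in _ + X]big_nat_cond [X in _ + X]big1 ?addr0 //.
  move=> p /andP[/andP[yp _] pp]; rewrite /lcm_count big_nat big1 ?mulr0 //.
  move=> v /andP[v2 _]; rewrite divn_small ?subn0 ?subnn //.
  apply: leq_trans Ny _; apply: (@leq_trans (p ^ 2)); first by rewrite leq_exp2r.
  by rewrite leq_exp2l // prime_gt1.
have -> : prime_sum (fun p => p%:R * lcm_count R k N p) y / N%:R ^+ k -
    prime_sum (prime_weight R k) y =
    prime_sum (fun p => p%:R * lcm_count R k N p / N%:R ^+ k - prime_weight R k p) y.
  by rewrite /prime_sum sumrB big_distrl.
apply: le_trans (ler_norm_sum _ _ _) _.
apply: (@le_trans _ _ (prime_sum (fun p => (k%:R + 2 ^+ k.+1) / N%:R *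
    ((trunc_log p N)%:R * p%:R)) y)).
  apply: le_prime_sum => p pp py; apply: le_trans (lcm_count_weight R pp _ k0) _.
    by apply: leq_trans yN; rewrite leq_exp2r.
  by rewrite mulrAC.
rewrite /prime_sum -big_distrr /=.
apply: le_trans (ler_wpM2l _ (sum_trunc_log R N2 yN)) _.
  by rewrite divr_ge0 // addr_ge0 // exprn_ge0.
rewrite (_ : _ * (600 * _) = (k%:R + 2 ^+ k.+1) * 600 / ln N%:R) //.
have : N%:R != 0 :> R by rewrite lt0r_neq0.
move: (ln N%:R : R) => l n0; rewrite -[in RHS](mulfVK n0 (_ * 600)); ring.
Qed.

End Assembly.

(** It remains to replace y = floor (sqrt x) and N = floor x by sqrt x and x. *)
Lemma sum_B_lcm_asymptotics (R : realType) k : (0 < k)%N -> exists C, forall x : R,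
  16 <= x ->
  `|sum_B_lcm k x -
    (k%:R * x ^+ k * ln (ln (Num.sqrt x)) + constH R k * x ^+ k)| <=
  C * (x ^+ k / ln x).
Proof.
move=> k0; have [K HK] := prime_sum_prime_weight R k0.
have K0 : 0 <= K.
  have l2 : 0 < ln 2 :> R by rewrite ln_gt0 // ltr1n.
  by have := le_trans (normr_ge0 _) (HK 2 erefl); rewrite pmulr_lge0 // invr_gt0.
set H := constH R k.
pose K1 : R := (k%:R + 2 ^+ k.+1) * 600.
have K10 : 0 <= K1.
  by apply: mulr_ge0; [rewrite addr_ge0 // exprn_ge0 | exact: ler0n].
exists (K1 * 2 + (K + k%:R) * 4 + k%:R * (k%:R + `|H|) * 16) => x x16.
have x0 : 0 < x by lra.
pose s := Num.sqrt x; pose N := Num.truncn x; pose y := Num.truncn s.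
have s0 : 0 < s by rewrite sqrtr_gt0.
have s2 : s ^+ 2 = x by rewrite sqr_sqrtr ?ltW.
have s4 : 4 <= s.
  by rewrite -(ler_pXn2r (n := 2)) ?nnegrE ?(ltW s0) // s2; lra.
have /andP[ys sy] := truncn_itv (ltW s0); rewrite -/y in ys sy.
have /andP[Nx xN] := truncn_itv (ltW x0); rewrite -/N in Nx xN.
have y4 : (4 <= y)%N by rewrite truncn_ge_nat // ltW.
have N16 : (16 <= N)%N by rewrite truncn_ge_nat // ltW.
have yR : 4 <= y%:R :> R by rewrite ler_nat.
have NR : 16 <= N%:R :> R by rewrite ler_nat.
have yN : (y ^ 2 <= N)%N.
  by rewrite truncn_ge_nat ?(ltW x0) // natrX -s2 lerXn2r ?nnegrE // ltW.
have Ny : (N < y.+1 ^ 2)%N.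
  by rewrite truncn_lt_nat ?(ltW x0) // natrX -s2 ltrXn2r // ltW.
have lx : ln x = 2 * ln s by rewrite -s2 lnXn // mulr_natl.
have ls1 : 1 <= ln s.
  have : ln 4 <= ln s by rewrite ler_ln ?posrE.
  rewrite (_ : 4 = 2 ^+ 2 :> R); last by rewrite -natrX.
  by rewrite lnXn // -(mulr_natl (ln 2)); have := ln2_ge_half R; lra.
have lnN : ln x <= 2 * ln N%:R.
  rewrite mulr_natl -lnXn; last by lra.
  rewrite ler_ln ?posrE ?exprn_gt0 //; try lra.
  by rewrite -natr1 in xN; apply: le_trans (ltW xN) _; rewrite expr2; nra.
have lny : ln x <= 4 * ln y%:R.
  suff : ln s <= 2 * ln y%:R by lra.
  rewrite mulr_natl -lnXn; last by lra.
  rewrite ler_ln ?posrE ?exprn_gt0 //; try lra.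
  by rewrite -natr1 in sy; apply: le_trans (ltW sy) _; rewrite expr2; nra.
have Lx : 0 < ln x by lra.
have Ly : 0 < ln y%:R :> R by lra.
have LN : 0 < ln N%:R :> R by lra.
have inv_le (c L : R) : 0 < c -> 0 < L -> ln x <= c * L -> L^-1 <= c / ln x.
  by move=> c0 L0 h; rewrite ler_pdivlMr // ler_pdivrMl // mulrC.
have iN := inv_le 2 _ (ltr0n _ 2) LN lnN.
have iy := inv_le 4 _ (ltr0n _ 4) Ly lny.
have N2 : (2 <= N)%N by rewrite (leq_trans _ N16).
have e1 := sum_B_lcm_weight k0 N2 yN Ny; rewrite -/K1 -/N in e1.
have y2 : (2 <= y)%N by rewrite (leq_trans _ y4).
have e2 := HK y y2; rewrite -/H in e2.
have y0 : 0 < y%:R :> R by lra.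
(* replacing y by sqrt x inside the double logarithm *)
have e3 : 0 <= ln (ln s) - ln (ln y%:R) <= (ln y%:R)^-1.
  have lys : ln y%:R <= ln s by rewrite ler_ln ?posrE.
  have ls0 : 0 < ln s by lra.
  apply/andP; split; first by rewrite subr_ge0 ler_ln ?posrE.
  apply: le_trans (ln_sub_le Ly ls0) _; rewrite ler_piMl ?invr_ge0 ?(ltW Ly) //.
  apply: le_trans (ln_sub_le y0 s0) _; rewrite ler_pdivrMr // mul1r.
  by rewrite -natr1 in sy; lra.
set G := sum_B_lcm k x in e1 *; set W := prime_sum _ y in e1 e2.
have Nk0 : 0 < N%:R ^+ k :> R by rewrite exprn_gt0 //; lra.
have Nk : N%:R ^+ k <= x ^+ k by rewrite lerXn2r ?nnegrE //; lra.
pose Z := k%:R * ln (ln s) + H.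
have eZ : `|G / N%:R ^+ k - Z| <= (K1 * 2 + (K + k%:R) * 4) / ln x.
  have kr : 0 <= k%:R * (ln (ln s) - ln (ln y%:R)) <= k%:R * (ln y%:R)^-1.
    by have /andP[h1 h2] := e3; rewrite mulr_ge0 ?ler_wpM2l.
  have a1 : K1 / ln N%:R <= K1 * (2 / ln x).
    exact: ler_wpM2l K10 _ _ iN.
  have a2 : (K + k%:R) / ln y%:R <= (K + k%:R) * (4 / ln x).
    by rewrite ler_wpM2l // addr_ge0.
  move: e1 e2 kr; rewrite !ler_norml /Z; lra.
have xk : 0 < x ^+ k by rewrite exprn_gt0.
(* the number of integers up to x is x + O(1) *)
have dNk : x ^+ k - N%:R ^+ k <= k%:R * (x ^+ k / x).
  have q1 : 0 <= N%:R / x <= 1.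
    by rewrite divr_ge0 ?(ltW x0) //= ler_pdivrMr // mul1r.
  have o1 : 0 <= (1 : R) <= 1 by rewrite ler01 lexx.
  have := lipschitz_expr k o1 q1; rewrite expr1n expr_div_n => h.
  have h1 : 1 - N%:R ^+ k / x ^+ k <= k%:R * x^-1.
    apply: le_trans (ler_norm _) (le_trans h _); rewrite ler_wpM2l //.
    rewrite ger0_norm; last by have /andP[_] := q1; lra.
    rewrite -(ler_pM2r x0) mulrBl mul1r divfK ?mulVf ?lt0r_neq0 //.
    by rewrite -natr1 in xN; lra.
  move: h1; rewrite -(ler_pM2l xk) mulrBr mulr1 mulrCA divff ?mulr1 ?lt0r_neq0 //.
  by rewrite mulrCA.
have l16 : ln x * ln x <= 16 * x.
  apply: (@le_trans _ _ (16 * s)); last first.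
    by rewrite ler_pM2l // -s2 expr2 ler_peMl ?(ltW s0) //; lra.
  have l4 := ln_le_root4 x0; rewrite -/s in l4.
  rewrite -(sqr_sqrtr (ltW s0)).
  apply: (@le_trans _ _ ((4 * Num.sqrt s) * (4 * Num.sqrt s))).
    by apply: ler_pM => //; exact: ltW.
  rewrite expr2; lra.
have Zle : `|Z| <= (k%:R + `|H|) * ln x.
  have ll0 : 0 <= ln (ln s) by rewrite ln_ge0.
  have ll1 : ln (ln s) <= ln x.
    by have := @ln_sublinear R (ln s); lra.
  apply: le_trans (ler_normD _ _) _.
  rewrite normrM (ger0_norm (ler0n R k)) (ger0_norm ll0).
  rewrite mulrDl lerD ?ler_wpM2l // ler_peMr //; lra.
have -> : G - (k%:R * x ^+ k * ln (ln (Num.sqrt x)) + H * x ^+ k) =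
    N%:R ^+ k * (G / N%:R ^+ k - Z) - (x ^+ k - N%:R ^+ k) * Z.
  rewrite mulrBr mulrCA divff ?mulr1 ?lt0r_neq0 // -/s /Z; ring.
apply: le_trans (ler_normB _ _) _; rewrite !normrM (gtr0_norm Nk0).
rewrite [_ * (x ^+ k / ln x)]mulrDl; apply: lerD.
  by rewrite (le_trans (ler_pM (ltW Nk0) (normr_ge0 _) Nk eZ)) // mulrCA.
rewrite ger0_norm ?subr_ge0 //.
apply: (@le_trans _ _ (k%:R * (x ^+ k / x) * ((k%:R + `|H|) * ln x))).
  by apply: ler_pM; rewrite ?subr_ge0.
have hx : ln x / x <= 16 / ln x.
  by rewrite ler_pdivrMr // mulrAC ler_pdivlMr // mulrC.
rewrite (_ : _ * _ * (_ * _) = (k%:R * (k%:R + `|H|) * x ^+ k) * (ln x / x)); last by ring.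
rewrite (_ : _ * 16 * _ = (k%:R * (k%:R + `|H|) * x ^+ k) * (16 / ln x)); last by ring.
by rewrite ler_wpM2l // !mulr_ge0 ?addr_ge0 // ltW.
Qed.


Theorem theorem9 (R : realType) (k : nat) (hk : (2 <= k)%N) :
  (fun x : R => sum_B_lcm k x) =
  (fun x : R => k%:R * x ^+ k * ln (ln (Num.sqrt x)) + constH R k * x ^+ k)
  +O_ (+oo%R) (fun x : R => x ^+ k / ln x).
Proof.
have [C HC] := sum_B_lcm_asymptotics R (ltnW hk).
apply/eqaddOP; near=> c; near=> x.
have x16 : 16 <= x by near: x; exact: nbhs_pinfty_ge.
have cC : C <= c by near: c; apply: nbhs_pinfty_ge; exact: num_real.
have x0 : 0 <= x by lra.
have x1 : 1 <= x by lra.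
have e0 : 0 <= x ^+ k / ln x by rewrite divr_ge0 ?exprn_ge0 ?ln_ge0.
rewrite (ger0_norm e0); apply: le_trans (HC x x16) _; exact: ler_wpM2r.
Unshelve. all: by end_near. Qed.
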